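(* Let $C$ be a smooth projective complex curve of genus $g$, let $\Theta\subset J(C)$ be a symmetric theta divisor, and let $2\le\ell\le g-1$. Let $p_1,\dots,p_\ell,q_1,\dots,q_{\ell-2}\in C$ be different points, and let $a_1,\dots,a_\ell\in J(C)$ be line bundles such that $$a_j\in\tfrac12\mathcal O_C\Big(2p_j+\sum_{i=1}^{\ell-2}q_i-\sum_{i=1}^{\ell}p_i\Big)\quad (j=1,\dots,\ell),$$ i.e. $2a_j=\mathcal O_C(2p_j+\sum_{i=1}^{\ell-2}q_i-\sum_{i=1}^{\ell}p_i)$, and such that $$a_j+a_k=\mathcal O_C\Big(p_j+p_k+\sum_{i=1}^{\ell-2}q_i-\sum_{i=1}^{\ell}p_i\Big)\quad\text{for all } j,k.$$ Assume that $a_1,\dots,a_\ell$ all lie on the smooth locus of $\Theta$ and on the same fiber of the Gauss map $\mathcal G$. Then $\mathcal G(a_i)\in\mathcal B_\ell$.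
   Context: Points of $J(C)$ are degree $0$ line bundles on $C$, written additively; $K$ is the canonical class. $\Theta$ is associated with a theta characteristic $\kappa$ (degree $g-1$, $2\kappa\equiv K$), with $\Theta=\{\mathcal O_C(D-\kappa): D\text{ effective of degree }g-1\}$. The Gauss map $\mathcal G:\Theta\dashrightarrow\mathbb P T_0J(C)^*\cong|K|$ is defined on the smooth locus of $\Theta$ and sends a point to the tangent hyperplane translated to the origin; identifying $\mathbb P T_0J(C)^*$ with the set $|K|$ of effective canonical divisors, for a smooth point $\mathcal O_C(D-\kappa)$ (i.e. $\dim H^0(C,\mathcal O_C(D))=1$) its image is the unique effective canonical divisor $\ge D$. For $1\le\ell\le g-1$, $\mathcal B_\ell\subseteq|K|$ is the set of effective canonical divisors of the form $\sum_{i=1}^{2\ell-2}P_i+2\sum_{j=1}^{g-\ell}Q_j$ with $P_i,Q_j\in C$ not necessarily distinct. *)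

(* Defs.v *)
From HB Require Import structures.
From mathcomp Require Import all_boot all_order all_algebra.
From mathcomp Require Import boolp reals complex mpoly freeg.

Set Implicit Arguments.
Unset Strict Implicit.
Unset Printing Implicit Defensive.

Import Order.TTheory GRing.Theory Num.Theory.
Local Open Scope ring_scope.

(* An integral projective curve C in P^n over the complex numbers R[i], given
   by its field of rational functions F = [ratfun] and its generic point
   [gen] = (x_0 : ... : x_n) in P^n(F), i.e. the restrictions to C of the
   homogeneous coordinates, divided by any one of them that does not vanish
   identically (only the ratios x_i / x_j matter).  The forms vanishing on C
   are those vanishing at the generic point; they generate a homogeneous prime
   ideal, and every integral projective curve arises in this way.  F consists
   of the quotients of forms of the same degree, and has transcendence degree
   one over R[i]. *)
Record proj_curve (R : realType) := ProjCurve {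
  adim : nat;
  ratfun : fieldType;
  cst : {rmorphism R[i] -> ratfun};
  gen : 'I_adim.+1 -> ratfun;
  gen_neq0 : exists i, gen i != 0;
  gen_ratfun : forall f : ratfun,
    exists d (G H : {mpoly R[i][adim.+1]}),
      [/\ G \is d.-homog, H \is d.-homog, mmap cst gen H != 0
        & f = mmap cst gen G / mmap cst gen H];
  trdeg_gt0 : exists t : ratfun, ~ algebraicOver cst t;
  trdeg_le1 : forall f : 'I_2 -> ratfun,
    exists2 Q : {mpoly R[i][2]}, Q != 0 & mmap cst f Q = 0
}.

Section Curve.
Context (R : realType) (C : proj_curve R).

Local Notation n := (adim C).
Local Notation F := (ratfun C).
Local Notation form := {mpoly R[i][n.+1]}.

Definition vanishes_on_curve (G : form) : Prop :=
  (exists d, G \is d.-homog) /\ mmap (cst C) (@gen R C) G = 0.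

(* Points of P^n are lines through the origin of R[i]^(n+1). *)
Definition on_curve (L : {vspace 'rV[R[i]]_n.+1}) : Prop :=
  (\dim L = 1)%N /\
  forall G, vanishes_on_curve G -> forall v, v \in L -> G.@[v ord0] = 0.

Record point := Point { line : {vspace 'rV[R[i]]_n.+1}; _ : `[< on_curve line >] }.

HB.instance Definition _ := [isSub for line].
HB.instance Definition _ := [Choice of point by <:].

(* Jacobian criterion: the matrix of the partial derivatives at v of the forms
   vanishing on C has rank n - 1, i.e. its kernel, which is the tangent space
   at v of the affine cone over C, has dimension 2. *)
Definition smooth : Prop :=
  forall (P : point) (v : 'rV[R[i]]_n.+1), v \in line P -> v != 0 ->
  exists2 T : {vspace 'rV[R[i]]_n.+1}, (\dim T = 2)%N &
    forall w, w \in T <->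
      forall G, vanishes_on_curve G ->
        \sum_(i < n.+1) (G^`M(i)).@[v ord0] * w ord0 i = 0.

Definition zero_at (P : point) (G : form) : Prop :=
  forall v, v \in line P -> G.@[v ord0] = 0.

(* f = G / H as rational functions on C, with H not vanishing at P *)
Definition local_frac (P : point) (f : F) (G H : form) : Prop :=
  [/\ exists2 d, G \is d.-homog & H \is d.-homog,
      ~ zero_at P H
    & f = mmap (cst C) (@gen R C) G / mmap (cst C) (@gen R C) H].

Definition local_ring (P : point) (f : F) : Prop :=
  exists G H, local_frac P f G H.

Definition local_max (P : point) (f : F) : Prop :=
  exists G H, local_frac P f G H /\ zero_at P G.

Definition local_unit (P : point) (f : F) : Prop :=
  exists G H, local_frac P f G H /\ ~ zero_at P G.

Definition uniformizer (P : point) (t : F) : Prop :=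
  local_max P t /\
  forall f, local_max P f -> exists2 u, local_ring P u & f = u * t.

(* ord_P f = k; in particular f is nonzero *)
Definition ord_at (P : point) (f : F) (k : int) : Prop :=
  exists t u, [/\ uniformizer P t, local_unit P u, t != 0 & f = u * t ^ k].

Definition derivation (d : F -> F) : Prop :=
  [/\ forall f h, d (f + h) = d f + d h,
      forall f h, d (f * h) = d f * h + f * d h
    & forall z, d (cst C z) = 0].

(* The order at P of the rational differential f dh: if t is a uniformizer at
   P and d = d/dt is the derivation of F over R[i] with d t = 1, then
   f dh = (f * d h) dt. *)
Definition ord_diff_at (P : point) (f h : F) (k : int) : Prop :=
  exists t d, [/\ uniformizer P t, derivation d, d t = 1 & ord_at P (f * d h) k].

Definition divisor := {freeg point / int}.

Definition effective (D : divisor) : Prop := forall P, 0 <= coeff P D.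

(* Linear equivalence.  A line bundle on C is represented by a divisor A with
   O_C(A) isomorphic to it, so [lin_equiv] is equality in Pic C; points of
   J(C) are represented by divisors of degree 0. *)
Definition lin_equiv (D E : divisor) : Prop :=
  exists f : F, forall P, ord_at P f (coeff P (D - E)).

(* Every nonzero rational differential has the form f dh. *)
Definition canonical (K : divisor) : Prop :=
  exists f h : F, forall P, ord_diff_at P f h (coeff P K).

(* H^0(C, O_C(D)) *)
Definition sections (D : divisor) (f : F) : Prop :=
  f = 0 \/ forall P, exists2 k, ord_at P f k & 0 <= k + coeff P D.

Definition has_dim (V : F -> Prop) (k : nat) : Prop :=
  exists b : 'I_k -> F,
    (forall f, V f <->
       exists c : 'I_k -> R[i], f = \sum_(i < k) cst C (c i) * b i) /\
    (forall c : 'I_k -> R[i],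
       \sum_(i < k) cst C (c i) * b i = 0 -> forall i, c i = 0).

Definition h0 (D : divisor) (k : nat) : Prop := has_dim (sections D) k.

(* g = dim H^0(C, K) *)
Definition has_genus (g : nat) : Prop :=
  exists2 K, canonical K & h0 K g.

Definition theta_characteristic (g : nat) (kappa : divisor) : Prop :=
  deg kappa = g%:Z - 1 /\
  exists2 K, canonical K & lin_equiv (kappa *+ 2) K.

(* A = O_C(D - kappa) with D effective of degree g - 1 *)
Definition theta_repr (g : nat) (kappa A D : divisor) : Prop :=
  [/\ effective D, deg D = g%:Z - 1 & lin_equiv A (D - kappa)].

(* The smooth locus of Theta = {O_C(D - kappa)}: by Riemann's singularity
   theorem, the points with h0(D) = 1. *)
Definition theta_smooth (g : nat) (kappa A : divisor) : Prop :=
  exists2 D, theta_repr g kappa A D & h0 D 1.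

(* The graph of the Gauss map Theta --> |K|, with P T_0 J(C)^* identified with
   |K|: the smooth point A = O_C(D - kappa) is sent to the effective canonical
   divisor M >= D.  By Riemann-Roch h0(K - D) = h0(D) = 1, so M is unique. *)
Definition gauss (g : nat) (kappa A M : divisor) : Prop :=
  exists D, [/\ theta_repr g kappa A D, h0 D 1,
    canonical M, effective M & effective (M - D)].

(* The locus B_l in |K| *)
Definition B_locus (g l : nat) (M : divisor) : Prop :=
  [/\ canonical M, effective M &
    exists (P : 'I_(2 * l - 2) -> point) (Q : 'I_(g - l) -> point),
      M = \sum_i << P i >> + (\sum_j << Q j >>) *+ 2].

End Curve.

(* Main.v *)
From HB Require Import structures.
Require Import Defs.
From mathcomp Require Import all_boot all_order all_algebra.
From mathcomp Require Import boolp reals complex mpoly freeg.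
From mathcomp Require classical_sets.
From mathcomp Require Import ring zify.

Set Implicit Arguments.
Unset Strict Implicit.
Unset Printing Implicit Defensive.

Import Order.TTheory GRing.Theory Num.Theory.
Local Open Scope ring_scope.

(** Write D_j for the effective divisor of degree g - 1 with a_j = D_j - kappa,
    and D'_j = M - D_j, which is effective since M is the image of a_j under
    the Gauss map.  The relations between the a_j give D_j - D_k ~ p_j - p_k
    for all j and k, and 2 kappa ~ M turns the relation on 2 a_j into
    D_j + sum_(i <> j) p_i ~ D'_j + p_j + sum q.

    The key point is that p_k occurs in D'_j when k <> j.  Otherwise let phi
    have divisor D_k + p_j - D_j - p_k, and let omega be a differential with
    divisor M.  If p_k occurs in D_k, then D_k - p_k + p_j is an effective
    divisor equivalent to D_j, hence equal to it because h0(D_j) = 1; comparing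
    the multiplicity of p_k in D_j and in D_k <= M shows that p_k occurs in D'_j
    after all.  If p_k does not occur in D_k, then phi omega has divisor
    D'_j + D_k + p_j - p_k: its only pole is p_k, and it is simple, which
    contradicts the residue theorem.

    As the p_k are distinct, D'_j = N + sum_(i <> j) p_i with N effective.
    Then D_j ~ N + p_j + sum q, and h0(D_j) = 1 forces equality, so that
    M = D_j + D'_j = 2 N + sum p + sum q with N of degree g - l.

    What remains is to prove on an abstract curve that no differential f dx
    has a simple pole as its only pole ([no_single_simple_pole]).  One may take
    x with a pole at the point p in question.  Let tau be the trace of f from
    K(x, f) to K(x), i.e. minus the subleading coefficient of its minimal polynomial.  In
    characteristic zero ramification is tame, so regularity of f dx above x = a
    means that (x - a) f vanishes there; therefore (x - a) tau vanishes at
    a, and tau is a polynomial in x.  At infinity x f vanishes above all points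
    but p, where it has a value c <> 0; therefore x tau has at infinity the value
    b c with b > 0, which no polynomial tau allows ([single_log_residue_eq0]).

    The values of a function u above s = 0 control its trace because every root
    of the reduction modulo s of the equation of u over K[s] is the value of
    u at some point ([trace_regular]): a root gives a proper ideal of K[s, u],
    which Zorn's lemma extends to a valuation ring ([exists_valuation_pair]),
    and the center of a valuation on a projective curve is a point, whose local
    ring is discrete and hence equal to the valuation ring ([exists_center],
    [curve_complete]).  The existence of a canonical divisor provides a
    uniformizer at every point. *)

(** * Local rings and valuation rings of a field *)

Section LocalRings.
Context (K : numClosedFieldType) (F : fieldType) (iota : {rmorphism K -> F}).

(** A K-subalgebra B of F with a proper ideal J, both given by their membership
    predicates, so that pairs can be compared inside F. *)
Record ideal_pair (B J : F -> Prop) : Prop := IdealPair {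
  pair_cst : forall c, B (iota c);
  pair_add : forall a b, B a -> B b -> B (a + b);
  pair_mul : forall a b, B a -> B b -> B (a * b);
  pair_sub : forall a, J a -> B a;
  pair_addI : forall a b, J a -> J b -> J (a + b);
  pair_mulI : forall a b, B a -> J b -> J (a * b);
  pair_proper : ~ J 1 }.

Record local_pair (B J : F -> Prop) : Prop := LocalPair {
  local_ideal :> ideal_pair B J;
  local_inv : forall a, B a -> ~ J a -> B a^-1 }.

Record valuation_pair (B J : F -> Prop) : Prop := ValuationPair {
  valuation_local :> local_pair B J;
  valuation_total : forall a, a != 0 -> B a \/ B a^-1 }.

Section IdealPairTheory.
Context (B J : F -> Prop) (BJ : ideal_pair B J).

Lemma pair_1 : B 1. Proof. by rewrite -(rmorph1 iota); apply: pair_cst BJ _. Qed.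
Lemma pair_0 : B 0. Proof. by rewrite -(rmorph0 iota); apply: pair_cst BJ _. Qed.
Lemma pair_opp a : B a -> B (- a).
Proof.
move=> Ba; rewrite -mulN1r -(rmorphN1 iota).
by apply: (pair_mul BJ) => //; apply: pair_cst BJ _.
Qed.
Lemma pair_subr a b : B a -> B b -> B (a - b).
Proof. by move=> Ba Bb; apply: (pair_add BJ) => //; apply: pair_opp. Qed.
Lemma pair_mulIr a b : J a -> B b -> J (a * b).
Proof. by move=> Ja Bb; rewrite mulrC; apply: (pair_mulI BJ). Qed.
Lemma pair_oppI a : J a -> J (- a).
Proof.
move=> Ja; rewrite -mulN1r.
by apply: (pair_mulI BJ) => //; apply: pair_opp; apply: pair_1.
Qed.
Lemma pair_subI a b : J a -> J b -> J (a - b).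
Proof. by move=> Ja Jb; apply: (pair_addI BJ) => //; apply: pair_oppI. Qed.
Lemma pair_exp a n : B a -> B (a ^+ n).
Proof.
by move=> Ba; elim: n => [|n IH]; rewrite ?expr0 ?exprS; [apply: pair_1|apply: (pair_mul BJ)].
Qed.
Lemma pair_sum (I : Type) (r : seq I) (P : pred I) (E : I -> F) :
  (forall i, P i -> B (E i)) -> B (\sum_(i <- r | P i) E i).
Proof. by move=> h; elim/big_ind: _ => //; [apply: pair_0|apply: (pair_add BJ)]. Qed.
Lemma pair_prod (I : Type) (r : seq I) (P : pred I) (E : I -> F) :
  (forall i, P i -> B (E i)) -> B (\prod_(i <- r | P i) E i).
Proof. by move=> h; elim/big_ind: _ => //; [apply: pair_1|apply: (pair_mul BJ)]. Qed.

Lemma pair_0I a : J a -> J 0.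
Proof. by move=> Ja; rewrite -(mul0r a); apply: (pair_mulI BJ) => //; apply: pair_0. Qed.

Lemma pair_unit_notI a : a != 0 -> B a^-1 -> ~ J a.
Proof.
move=> a0 Ba Ja; apply: (pair_proper BJ).
by rewrite -(mulVf a0); apply: (pair_mulI BJ).
Qed.

Lemma pair_cstI c : J (iota c) -> c = 0.
Proof.
move=> Jc; apply/eqP/negP => /negP c0; apply: (pair_unit_notI _ _ Jc); rewrite ?fmorph_eq0 //.
by rewrite -fmorphV; apply: pair_cst BJ _.
Qed.

End IdealPairTheory.

Section LocalPairTheory.
Context (B J : F -> Prop) (BJ : local_pair B J).

Lemma local_prime a b : B a -> B b -> J (a * b) -> J a \/ J b.
Proof.
move=> Ba Bb Jab; case: (pselect (J a)) => [|nJa]; [by left|right].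
have [a0|a0] := eqVneq a 0; first by case: nJa; rewrite a0; apply: (pair_0I BJ Jab).
by rewrite -(mulKf a0 b); apply: (pair_mulI BJ) => //; apply: (local_inv BJ).
Qed.

Lemma local_inv_notI a : B a -> ~ J a -> ~ J a^-1.
Proof.
move=> Ba nJ JV; have [a0|a0] := eqVneq a 0; first by case: nJ; move: JV; rewrite a0 invr0.
by apply: (pair_unit_notI BJ _ _ JV); rewrite ?invr_eq0 ?invrK.
Qed.

End LocalPairTheory.

Section Domination.
Context (B0 J0 : F -> Prop) (BJ0 : ideal_pair B0 J0) (J00 : J0 0).

Let pairs := {s : (F -> Prop) * (F -> Prop) |
  ideal_pair s.1 s.2 /\ ((forall y, B0 y -> s.1 y) /\ (forall y, J0 y -> s.2 y))}.
Let below (s t : pairs) : bool :=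
  `[< (forall y, (sval s).1 y -> (sval t).1 y) /\
      (forall y, (sval s).2 y -> (sval t).2 y) >].

Let exists_maximal_pair : exists B J, [/\ ideal_pair B J,
  (forall y, B0 y -> B y), (forall y, J0 y -> J y)
  & forall B' J', ideal_pair B' J' -> (forall y, B y -> B' y) ->
      (forall y, J y -> J' y) ->
    (forall y, B' y -> B y) /\ (forall y, J' y -> J y)].
Proof.
have t0 : pairs by exists (B0, J0).
have [||A totA|[[B J] HBJ] tmax] := @classical_sets.ZL_preorder pairs t0 below.
- by move=> t; apply/asboolP.
- move=> r s t /asboolP [rs1 rs2] /asboolP [st1 st2]; apply/asboolP.
  by split=> y Hy; [apply: st1; apply: rs1|apply: st2; apply: rs2].
- case: (pselect (exists s, A s)) => [[s As]|nA]; last first.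
    by exists t0 => s As; case: nA; exists s.
  pose B y := exists2 s, A s & (sval s).1 y.
  pose J y := exists2 s, A s & (sval s).2 y.
  have tot s1 s2 : A s1 -> A s2 -> exists s3, [/\ A s3, below s1 s3 & below s2 s3].
    move=> A1 A2; case: (totA _ _ A1 A2) => h; [exists s2|exists s1];
    by split=> //; apply/asboolP.
  have iBJ : ideal_pair B J.
    split.
    - by move=> c; exists s => //; apply: (pair_cst (svalP s).1).
    - move=> a b [s1 A1 H1] [s2 A2 H2];
      have [s3 [A3 /asboolP [l1 _] /asboolP [l2 _]]] := tot _ _ A1 A2.
      by exists s3 => //; apply: (pair_add (svalP s3).1); [apply: l1|apply: l2].
    - move=> a b [s1 A1 H1] [s2 A2 H2];
      have [s3 [A3 /asboolP [l1 _] /asboolP [l2 _]]] := tot _ _ A1 A2.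
      by exists s3 => //; apply: (pair_mul (svalP s3).1); [apply: l1|apply: l2].
    - by move=> a [s1 A1 H1]; exists s1 => //; apply: (pair_sub (svalP s1).1).
    - move=> a b [s1 A1 H1] [s2 A2 H2];
      have [s3 [A3 /asboolP [_ l1] /asboolP [_ l2]]] := tot _ _ A1 A2.
      by exists s3 => //; apply: (pair_addI (svalP s3).1); [apply: l1|apply: l2].
    - move=> a b [s1 A1 H1] [s2 A2 H2];
      have [s3 [A3 /asboolP [l1 _] /asboolP [_ l2]]] := tot _ _ A1 A2.
      by exists s3 => //; apply: (pair_mulI (svalP s3).1); [apply: l1|apply: l2].
    - by move=> [s1 A1 H1]; apply: (pair_proper (svalP s1).1).
  have lBJ : (forall y, B0 y -> B y) /\ (forall y, J0 y -> J y).
    split=> y Hy; exists s => //; [exact: (svalP s).2.1|exact: (svalP s).2.2].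
  exists (exist _ (B, J) (conj iBJ lBJ)) => s1 A1; apply/asboolP.
  by split=> y Hy; exists s1.
- have [/= iBJ [lB lJ]] := HBJ; exists B, J; split=> // B' J' iBJ' BB' JJ'.
  have lBJ' : (forall y, B0 y -> B' y) /\ (forall y, J0 y -> J' y).
    by split=> y Hy; [apply: BB'; apply: lB|apply: JJ'; apply: lJ].
  have /tmax /asboolP : below (exist _ (B, J) HBJ)
     (exist _ (B', J') (conj iBJ' lBJ')) by apply/asboolP.
  by [].
Qed.

(** The degree of the longer of the two relations can be lowered: the other one
    expresses the top power of y through smaller ones, since 1 - q_0 is a unit. *)
Lemma no_double_relation (B J : F -> Prop) (BJ : local_pair B J) (y : F) :
  J 0 -> y != 0 ->
  forall p q : {poly F}, (forall i, J p`_i) -> (forall i, J q`_i) ->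
  p.[y] = 1 -> q.[y^-1] = 1 -> False.
Proof.
move=> zJ + p q; have [n] := ubnP (size p + size q).
elim: n y p q => // n IH y p q le_n y0 Jp Jq py qy.
wlog le_qp : y p q le_n y0 Jp Jq py qy / (size q <= size p)%N.
  move=> W; have [h|/ltnW h] := leqP (size q) (size p); first exact: (W y p q).
  by apply: (W y^-1 q p); rewrite ?invrK ?invr_eq0 // addnC.
have [N szp] : exists N, size p = N.+1.
  case: (size p) (@size_poly_eq0 _ p) => [|N _]; last by exists N.
  move=> /esym/eqP p0; move: py; rewrite p0 horner0 => /esym/eqP; by rewrite oner_eq0.
(* R is y^N (1 - q (1/y)) written as a polynomial in y. *)
pose R := 'X^N - \sum_(i < size q) q`_i *: 'X^(N - i) : {poly F}.
have q0J : ~ J (1 - q`_0).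
  move=> h; apply: (pair_proper BJ); rewrite -(subrK q`_0 1).
  by apply: (pair_addI BJ).
have q0B : B (1 - q`_0) by apply: (pair_subr BJ); [apply: (pair_1 BJ)|apply: (pair_sub BJ)].
have q0n : 1 - q`_0 != 0 by apply/negP => /eqP h; apply: q0J; rewrite h.
have [m szq] : exists m, size q = m.+1.
  case: (size q) (@size_poly_eq0 _ q) => [|m _]; last by exists m.
  move=> /esym/eqP p0; move: qy; rewrite p0 horner0 => /esym/eqP; by rewrite oner_eq0.
have Ry : R.[y] = 0.
  rewrite /R hornerD hornerN hornerXn horner_sum.
  rewrite (eq_bigr (fun i : 'I_(size q) => y ^+ N * (q`_i * y^-1 ^+ i))).
    by rewrite -mulr_sumr -horner_coef qy mulr1 subrr.
  move=> i _; rewrite hornerZ hornerXn mulrCA; congr (_ * _).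
  rewrite exprVn expfB_cond // (negbTE y0) add0n -ltnS -szp.
  by apply: leq_trans le_qp.
have RN : R`_N = 1 - q`_0.
  rewrite /R coefB coefXn eqxx coef_sum szq big_ord_recl /= coefZ coefXn subn0 eqxx mulr1.
  rewrite big1 ?addr0 // => i _; rewrite coefZ coefXn /bump leq0n add1n.
  have : (i.+1 <= N)%N by rewrite -ltnS -szp (leq_trans _ le_qp) // szq ltnS.
  move=> h; rewrite eqn_leq [X in X && _](_ : _ = false) ?mulr0 //.
  by apply/negbTE; rewrite -ltnNge; lia.
have RB i : B R`_i.
  rewrite /R coefB; apply: (pair_subr BJ).
    by rewrite coefXn; case: eqP => _; [apply: (pair_1 BJ)|apply: (pair_0 BJ)].
  rewrite coef_sum; apply: (pair_sum BJ) => j _; rewrite coefZ coefXn.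
  apply: (pair_mul BJ); first exact: (pair_sub BJ).
  by case: eqP => _; [apply: (pair_1 BJ)|apply: (pair_0 BJ)].
have szR : (size R <= N.+1)%N.
  apply/leq_sizeP => j lt_j; rewrite /R coefB coefXn coef_sum.
  rewrite (gtn_eqF lt_j) big1 ?subr0 // => i _; rewrite coefZ coefXn.
  by rewrite gtn_eqF ?mulr0 // (leq_ltn_trans (leq_subr _ _)).
pose lam := p`_N / (1 - q`_0).
have lamJ : J lam by apply: (pair_mulIr BJ) => //; apply: (local_inv BJ).
apply: (IH y (p - lam *: R) q) => //.
- apply: leq_trans (_ : (size p + size q <= n)%N) => //.
  rewrite ltn_add2r szp ltnS; apply/leq_sizeP => j le_j.
  rewrite coefB coefZ; move: le_j; rewrite leq_eqVlt => /orP [/eqP <-|lt_j].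
    by rewrite RN /lam divfK // subrr.
  by rewrite !nth_default ?mulr0 ?subr0 ?szp // (leq_trans szR).
- move=> i; rewrite coefB coefZ; apply: (pair_subI BJ) => //.
  exact: (pair_mulIr BJ).
- by rewrite hornerD hornerN hornerZ Ry mulr0 subr0.
Qed.

(** Chevalley's extension theorem.  In a maximal pair the elements of 1 + J are
    invertible (adjoin their inverses), so B is local with maximal ideal J; and B contains y or 1/y,
    since otherwise J generates the unit ideal in both B[y] and B[1/y]. *)
Theorem exists_valuation_pair : exists B J, [/\ valuation_pair B J,
  (forall y, B0 y -> B y) & (forall y, J0 y -> J y)].
Proof.
have [B [J [iBJ lB lJ maxBJ]]] := exists_maximal_pair.
have zJ : J 0 by apply: lJ.
(* The fractions with denominators in 1 + J form a larger pair. *)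
have inv1 j : J j -> B (1 + j)^-1.
  move=> Jj.
  have nz i : J i -> 1 + i != 0.
    move=> Ji; apply/negP; rewrite addr_eq0 => /eqP h.
    by apply: (pair_proper iBJ); rewrite h; apply: (pair_oppI iBJ).
  have unit_mul i i' : J i -> J i' -> exists2 i'', J i'' & (1 + i) * (1 + i') = 1 + i''.
    move=> Ji Ji'; exists (i + i' + i * i'); last by ring.
    apply: (pair_addI iBJ); first exact: (pair_addI iBJ).
    by apply: (pair_mulI iBJ) => //; apply: (pair_sub iBJ).
  have B1 i : J i -> B (1 + i).
    by move=> Ji; apply: (pair_add iBJ); [apply: (pair_1 iBJ)|apply: (pair_sub iBJ)].
  pose B' y := exists b i, [/\ B b, J i & y = b / (1 + i)].
  pose J' y := exists b i, [/\ J b, J i & y = b / (1 + i)].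
  have iBJ' : ideal_pair B' J'.
    split.
    - by move=> c; exists (iota c), 0; rewrite addr0 divr1; split=> //; apply: (pair_cst iBJ).
    - move=> _ _ [b [i [Bb Ji ->]]] [b' [i' [Bb' Ji' ->]]].
      have [i'' Ji'' E] := unit_mul _ _ Ji Ji'.
      exists (b * (1 + i') + b' * (1 + i)), i''; split=> //.
        by apply: (pair_add iBJ); apply: (pair_mul iBJ) => //; apply: B1.
      by rewrite addf_div ?nz // E.
    - move=> _ _ [b [i [Bb Ji ->]]] [b' [i' [Bb' Ji' ->]]].
      have [i'' Ji'' E] := unit_mul _ _ Ji Ji'.
      exists (b * b'), i''; split=> //; first exact: (pair_mul iBJ).
      by rewrite mulf_div E.
    - by move=> _ [b [i [Jb Ji ->]]]; exists b, i; split=> //; apply: (pair_sub iBJ).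
    - move=> _ _ [b [i [Bb Ji ->]]] [b' [i' [Bb' Ji' ->]]].
      have [i'' Ji'' E] := unit_mul _ _ Ji Ji'.
      exists (b * (1 + i') + b' * (1 + i)), i''; split=> //.
        by apply: (pair_addI iBJ); apply: (pair_mulIr iBJ) => //; apply: B1.
      by rewrite addf_div ?nz // E.
    - move=> _ _ [b [i [Bb Ji ->]]] [b' [i' [Bb' Ji' ->]]].
      have [i'' Ji'' E] := unit_mul _ _ Ji Ji'.
      exists (b * b'), i''; split=> //; first exact: (pair_mulI iBJ).
      by rewrite mulf_div E.
    - move=> [b [i [Jb Ji]]] /esym/divr1_eq E.
      by apply: (pair_proper iBJ); rewrite -(addrK i 1) -E; apply: (pair_subI iBJ).
  apply: (maxBJ B' J' iBJ' _ _).1.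
  - by move=> y By; exists y, 0; rewrite addr0 divr1.
  - by move=> y Jy; exists y, 0; rewrite addr0 divr1.
  - by exists 1, j; split=> //; rewrite ?div1r //; apply: (pair_1 iBJ).
have invB a : B a -> ~ J a -> B a^-1.
  move=> Ba nJa.
  (* By maximality, the ideal generated by J and a is the whole ring. *)
  pose J' y := exists j b, [/\ J j, B b & y = j + b * a].
  case: (pselect (J' 1)) => [[j [b [Jj Bb E]]]|nJ'].
    have E' : 1 + - j = b * a by rewrite {1}E; ring.
    have u : B (1 + - j)^-1 by apply: inv1; apply: (pair_oppI iBJ).
    have [b0|b0] := eqVneq b 0.
      by case: (pair_proper iBJ); rewrite E b0 mul0r addr0.
    suff -> : a^-1 = b * (1 + - j)^-1 by apply: (pair_mul iBJ).
    have [a0|a0] := eqVneq a 0; last by rewrite E' invfM mulrA mulfV // mul1r.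
    by case: nJa; rewrite a0.
  have iBJ' : ideal_pair B J'.
    split; try by case: iBJ.
    - move=> _ [j [b [Jj Bb ->]]]; apply: (pair_add iBJ); first exact: (pair_sub iBJ).
      exact: (pair_mul iBJ).
    - move=> _ _ [j [b [Jj Bb ->]]] [j' [b' [Jj' Bb' ->]]].
      exists (j + j'), (b + b'); split; last by ring.
        exact: (pair_addI iBJ).
      exact: (pair_add iBJ).
    - move=> c _ Bc [j [b [Jj Bb ->]]].
      exists (c * j), (c * b); split; last by ring.
        exact: (pair_mulI iBJ).
      exact: (pair_mul iBJ).
  case: nJa; apply: (maxBJ B J' iBJ' _ _).2 => //.
    move=> y Jy; exists y, 0; split=> //; first exact: (pair_0 iBJ).
    by rewrite mul0r addr0.
  exists 0, 1; split=> //; first exact: (pair_1 iBJ).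
  by rewrite add0r mul1r.
have lBJ : local_pair B J by split.
exists B, J; split=> //; split=> // y y0.
have adjoin z : ~ B z -> exists2 p : {poly F}, (forall i, J p`_i) & p.[z] = 1.
  move=> nBz.
  pose B' w := exists2 p : {poly F}, (forall i, B p`_i) & w = p.[z].
  pose J' w := exists2 p : {poly F}, (forall i, J p`_i) & w = p.[z].
  case: (pselect (J' 1)) => [[p Jp E]|nJ']; first by exists p.
  have iBJ' : ideal_pair B' J'.
    split=> //.
    - move=> c; exists (iota c)%:P; last by rewrite hornerC.
      by move=> i; rewrite coefC; case: eqP => _; [apply: (pair_cst iBJ)|apply: (pair_0 iBJ)].
    - move=> _ _ [p Bp ->] [q Bq ->]; exists (p + q); last by rewrite hornerD.
      by move=> i; rewrite coefD; apply: (pair_add iBJ).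
    - move=> _ _ [p Bp ->] [q Bq ->]; exists (p * q); last by rewrite hornerM.
      by move=> i; rewrite coefM; apply: (pair_sum iBJ) => k _; apply: (pair_mul iBJ).
    - by move=> _ [p Jp ->]; exists p => // i; apply: (pair_sub iBJ).
    - move=> _ _ [p Bp ->] [q Bq ->]; exists (p + q); last by rewrite hornerD.
      by move=> i; rewrite coefD; apply: (pair_addI iBJ).
    - move=> _ _ [p Bp ->] [q Bq ->]; exists (p * q); last by rewrite hornerM.
      move=> i; rewrite coefM; elim/big_ind: _ => //; first exact: (pair_addI iBJ).
      by move=> k _; apply: (pair_mulI iBJ).
  case: nBz; apply: (maxBJ B' J' iBJ' _ _).1.
  - move=> w Bw; exists w%:P; last by rewrite hornerC.
    by move=> i; rewrite coefC; case: eqP => // _; apply: (pair_0 iBJ).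
  - move=> w Bw; exists w%:P; last by rewrite hornerC.
    by move=> i; rewrite coefC; case: eqP.
  - exists 'X; last by rewrite hornerX.
    by move=> i; rewrite coefX; case: eqP => _; [apply: (pair_1 iBJ)|apply: (pair_0 iBJ)].
case: (pselect (B y)) => [|nBy]; [by left|right].
case: (pselect (B y^-1)) => // nBz.
have [p Jp py] := adjoin _ nBy; have [q Jq qy] := adjoin _ nBz.
by case: (no_double_relation lBJ zJ y0 Jp Jq py qy).
Qed.

End Domination.
End LocalRings.

(** * Rational functions and minimal polynomials *)

Section Evaluation.
Context (K : numClosedFieldType) (F : fieldType) (iota : {rmorphism K -> F}).

Definition ev1 (x : F) : {poly K} -> F := horner_eval x \o map_poly iota.
HB.instance Definition _ x :=
  GRing.RMorphism.copy (ev1 x) (horner_eval x \o map_poly iota).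

(** In {poly {poly K}} the inner variable is evaluated at x, the outer one
    at y. *)
Definition ev2 (x y : F) : {poly {poly K}} -> F := horner_eval y \o map_poly (ev1 x).
HB.instance Definition _ x y :=
  GRing.RMorphism.copy (ev2 x y) (horner_eval y \o map_poly (ev1 x)).

Lemma ev1B x : {morph ev1 x : A B / A - B}. Proof. exact: rmorphB. Qed.
Lemma ev1D x : {morph ev1 x : A B / A + B}. Proof. exact: rmorphD. Qed.
Lemma ev1M x : {morph ev1 x : A B / A * B}. Proof. exact: rmorphM. Qed.
Lemma ev2B x y : {morph ev2 x y : A B / A - B}. Proof. exact: rmorphB. Qed.
Lemma ev2D x y : {morph ev2 x y : A B / A + B}. Proof. exact: rmorphD. Qed.
Lemma ev2M x y : {morph ev2 x y : A B / A * B}. Proof. exact: rmorphM. Qed.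

Lemma ev1C x c : ev1 x c%:P = iota c.
Proof. by rewrite /ev1 /= map_polyC /horner_eval hornerC. Qed.
Lemma ev1X x : ev1 x 'X = x.
Proof. by rewrite /ev1 /= map_polyX /horner_eval hornerX. Qed.
Lemma ev2C x y A : ev2 x y A%:P = ev1 x A.
Proof. by rewrite /ev2 /= map_polyC /horner_eval hornerC. Qed.
Lemma ev2X x y : ev2 x y 'X = y.
Proof. by rewrite /ev2 /= map_polyX /horner_eval hornerX. Qed.
Lemma ev1E x A : ev1 x A = \sum_(i < size A) iota A`_i * x ^+ i.
Proof.
rewrite -{1}[A]coefK poly_def rmorph_sum; apply: eq_bigr => i _.
by rewrite -mul_polyC rmorphM rmorphXn /= ev1C ev1X.
Qed.
Lemma ev2E x y Q : ev2 x y Q = \sum_(i < size Q) ev1 x Q`_i * y ^+ i.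
Proof.
rewrite -{1}[Q]coefK poly_def rmorph_sum; apply: eq_bigr => i _.
by rewrite -mul_polyC rmorphM rmorphXn /= ev2C ev2X.
Qed.

(** The remainder modulo the outer variable, used for relations Q (x, y) = 0
    with Q (x, 0) <> 0. *)
Lemma ev2_split x y Q : exists Q1, ev2 x y Q = ev2 x y Q1 * y + ev1 x Q`_0.
Proof.
pose Q1 := \poly_(i < (size Q).-1) Q`_i.+1; exists Q1.
suff EQ : Q = Q1 * 'X + (Q`_0)%:P by rewrite {1}EQ ev2D ev2M ev2X ev2C.
apply/polyP => -[|i]; rewrite coefD coefMX coefC /= ?add0r ?addr0 // coef_poly.
by case: ltnP => // h; rewrite nth_default // -(leq_add2r 1) ?addn1; move: h; case: (size Q).
Qed.

Lemma ev1_comp x A B : ev1 x (A \Po B) = ev1 (ev1 x B) A.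
Proof. by rewrite /ev1 /= map_comp_poly /horner_eval horner_comp. Qed.

Definition transcendental x := forall A : {poly K}, ev1 x A = 0 -> A = 0.

Lemma algebraic_cst x A : A != 0 -> ev1 x A = 0 -> exists c, x = iota c.
Proof.
move=> A0; have [r E] := closed_field_poly_normal A.
rewrite {1}E -mul_polyC ev1M ev1C => /eqP.
rewrite mulf_eq0 fmorph_eq0 lead_coef_eq0 (negbTE A0) rmorph_prod prodf_seq_eq0 /=.
move=> /hasP [/= c _]; rewrite ev1B ev1X ev1C subr_eq0 => /eqP ->.
by exists c.
Qed.

Lemma not_cst_transcendental x : (forall c, x <> iota c) -> transcendental x.
Proof.
move=> h A E; apply/eqP/negP => /negP A0.
by have [c xc] := algebraic_cst A0 E; case: (h c).
Qed.

Lemma transcendental_inj x : transcendental x -> injective (ev1 x).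
Proof.
move=> tx A B /eqP; rewrite -subr_eq0 -rmorphB => /eqP /tx /eqP.
by rewrite subr_eq0 => /eqP.
Qed.

Lemma transcendental_eq0 x A : transcendental x -> (ev1 x A == 0) = (A == 0).
Proof. by move=> tx; apply/eqP/eqP => [/tx|->]; rewrite ?rmorph0. Qed.

Lemma ev1_closed (B J : F -> Prop) (BJ : ideal_pair iota B J) x A : B x -> B (ev1 x A).
Proof.
move=> Bx; rewrite ev1E; apply: (pair_sum BJ) => i _.
by apply: (pair_mul BJ); [apply: (pair_cst BJ)|apply: (pair_exp BJ)].
Qed.

(** An element of J reduces to 0, so polynomials in it reduce to their constant
    coefficients. *)
Lemma ev1_mod (B J : F -> Prop) (BJ : ideal_pair iota B J) x A : J x -> J (ev1 x A - iota A.[0]).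
Proof.
move=> Jx; rewrite -(ev1C x) -rmorphB /=.
have /factor_theorem [q ->] : root (A - A.[0]%:P) 0 by rewrite /root !hornerE subrr.
rewrite subr0 rmorphM /= ev1X; apply: (pair_mulI BJ) => //.
by apply: (ev1_closed BJ); apply: (pair_sub BJ).
Qed.

Lemma ev1_unit (B J : F -> Prop) (BJ : ideal_pair iota B J) x A :
  J x -> A.[0] != 0 -> ~ J (ev1 x A).
Proof.
move=> Jx /eqP A0 JA; apply: A0; apply: (pair_cstI BJ).
by rewrite -[iota _](subKr (ev1 x A)); apply: (pair_subI BJ) => //; apply: (ev1_mod BJ).
Qed.

(** The subfield K(s) of F. *)
Definition rational (s y : F) : Prop :=
  exists A B, ev1 s B != 0 /\ y = ev1 s A / ev1 s B.

Section Rational.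
Context (s : F).
Lemma rational_ev1 A : rational s (ev1 s A).
Proof. by exists A, 1; rewrite rmorph1 oner_eq0 divr1. Qed.
Lemma rational_gen : rational s s. Proof. by rewrite -{2}(ev1X s); apply: rational_ev1. Qed.
Lemma rational_cst c : rational s (iota c). Proof. by rewrite -(ev1C s); apply: rational_ev1. Qed.
Lemma rational0 : rational s 0. Proof. by rewrite -(rmorph0 iota); apply: rational_cst. Qed.
Lemma rational1 : rational s 1. Proof. by rewrite -(rmorph1 iota); apply: rational_cst. Qed.
Lemma rationalD x y : rational s x -> rational s y -> rational s (x + y).
Proof.
move=> [A [B [B0 ->]]] [A' [B' [B'0 ->]]].
exists (A * B' + A' * B), (B * B'); rewrite rmorphM mulf_neq0 //=; split=> //.
by rewrite rmorphD !rmorphM addf_div.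
Qed.
Lemma rationalM x y : rational s x -> rational s y -> rational s (x * y).
Proof.
move=> [A [B [B0 ->]]] [A' [B' [B'0 ->]]].
exists (A * A'), (B * B'); rewrite rmorphM mulf_neq0 //=; split=> //.
by rewrite !rmorphM mulf_div.
Qed.
Lemma rationalV x : rational s x -> rational s x^-1.
Proof.
move=> [A [B [B0 ->]]]; rewrite invf_div; have [E|A0] := eqVneq (ev1 s A) 0.
  by rewrite E invr0 mulr0; apply: rational0.
by exists B, A.
Qed.
Lemma rational_exp x n : rational s x -> rational s (x ^+ n).
Proof. by move=> sx; elim: n => [|n IH]; rewrite ?exprS; [apply: rational1|apply: rationalM]. Qed.
End Rational.

Lemma rational_trans r s y : rational r s -> rational s y -> rational r y.
Proof.
have E A : rational r s -> rational r (ev1 s A).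
  move=> rs; rewrite ev1E; elim/big_ind: _ => [|x z|i _]; first exact: rational0.
    exact: rationalD.
  by apply: rationalM; [apply: rational_cst|apply: rational_exp].
move=> rs [A [B [_ ->]]]; apply: rationalM; first exact: E.
by apply: rationalV; apply: E.
Qed.

Definition minimal_poly (s u : F) (chi : {poly F}) : Prop :=
  [/\ chi \is monic, forall i, rational s chi`_i, root chi u
    & forall q : {poly F}, q != 0 -> (forall i, rational s q`_i) -> root q u ->
        (size chi <= size q)%N].

Lemma minimal_poly_size s u chi : minimal_poly s u chi -> (1 < size chi)%N.
Proof.
move=> [chi1 _ ru _]; apply: root_size_gt1 ru.
exact: monic_neq0.
Qed.

Lemma exists_minimal_poly s u (Q : {poly {poly K}}) :
  transcendental s -> Q != 0 -> ev2 s u Q = 0 -> exists chi, minimal_poly s u chi.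
Proof.
move=> ts Q0 Qsu.
pose good (q : {poly F}) := [/\ q != 0, forall i, rational s q`_i & root q u].
have ex : exists n, `[< exists2 q, good q & size q = n >].
  exists (size (map_poly (ev1 s) Q)); apply/asboolP; exists (map_poly (ev1 s) Q) => //.
  split=> //; last by rewrite /root; apply/eqP.
    by rewrite map_poly_eq0_id0 ?transcendental_eq0 ?lead_coef_eq0.
  by move=> i; rewrite coef_map; apply: rational_ev1.
case: (ex_minnP ex) => n /asboolP [q [q0 sq ru] szq] minq.
exists ((lead_coef q)^-1 *: q); have lq : (lead_coef q)^-1 != 0 by rewrite invr_eq0 lead_coef_eq0.
split.
- by rewrite monicE lead_coefZ mulVf // lead_coef_eq0.
- by move=> i; rewrite coefZ; apply: rationalM => //; apply: rationalV; exact: sq.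
- by rewrite rootZ.
- move=> r r0 sr rr; rewrite size_scale // szq; apply: minq; apply/asboolP; by exists r.
Qed.

(** Changing the coordinate s on the projective line does not change K(s). *)
Lemma minimal_poly_rational s r u chi :
  rational r s -> rational s r -> minimal_poly s u chi -> minimal_poly r u chi.
Proof.
move=> rs sr [m rc ru mn]; split=> // [i|q q0 rq rqu]; first exact: (rational_trans rs (rc i)).
by apply: mn => // i; apply: (rational_trans sr (rq i)).
Qed.

(** Only the coefficients are rescaled; in particular the trace of lam * u is
    lam times that of u. *)
Lemma minimal_poly_scale s u lam chi : rational s lam -> lam != 0 ->
  minimal_poly s u chi ->
  minimal_poly s (lam * u) (\poly_(i < size chi) (chi`_i * lam ^+ ((size chi).-1 - i))).
Proof.
move=> slam lam0 mchi; have szchi := ltnW (minimal_poly_size mchi).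
move: mchi => [mon sc ru mn].
have szn : size chi = (size chi).-1.+1 by rewrite prednK.
set chi' := \poly_(i < _) _.
have lc : chi'`_(size chi).-1 = 1.
  by rewrite coef_poly {2}szn leqnn subnn mulr1; apply/eqP.
have sz' : size chi' = size chi.
  apply/eqP; rewrite eqn_leq size_poly /= [X in (X <= _)%N]szn ltnNge.
  by apply/negP => /(nth_default 0) /eqP; rewrite lc oner_eq0.
split.
- by rewrite monicE lead_coefE sz' lc.
- move=> i; rewrite coef_poly; case: ifP => _; last exact: rational0.
  by apply: rationalM => //; apply: rational_exp.
- rewrite /root horner_poly.
  rewrite (eq_bigr (fun i : 'I_(size chi) => lam ^+ (size chi).-1 * (chi`_i * u ^+ i))).
    by rewrite -mulr_sumr -horner_coef (eqP ru) mulr0.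
  move=> i _; have le_i : (i <= (size chi).-1)%N by rewrite -ltnS -szn.
  by rewrite exprMn -{2}(subnK le_i) exprD; ring.
- move=> q q0 sq rq; rewrite sz'.
  have lX : size (lam *: 'X : {poly F}) = 2%N by rewrite size_scale // size_polyX.
  have -> : size q = size (q \Po (lam *: 'X)) by rewrite size_comp_poly2.
  apply: mn.
  + by rewrite -size_poly_eq0 size_comp_poly2 // size_poly_eq0.
  + move=> i; have -> : (q \Po (lam *: 'X))`_i = q`_i * lam ^+ i; last first.
      by apply: rationalM => //; apply: rational_exp.
    rewrite comp_polyE coef_sum.
    under eq_bigr do rewrite exprZn !coefZ coefXn.
    have [lt_i|le_i] := ltnP i (size q).
      rewrite (bigD1 (Ordinal lt_i)) //= eqxx mulr1 big1 ?addr0 // => j.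
      by rewrite -val_eqE /= eq_sym => /negbTE ->; rewrite !mulr0.
    rewrite nth_default // mul0r big1 // => j _.
    by rewrite (gtn_eqF (leq_trans (ltn_ord j) le_i)) !mulr0.
  + by rewrite /root horner_comp !hornerE.
Qed.

Lemma clear_denominators s (chi : {poly F}) : (forall i, rational s chi`_i) ->
  exists D (Phi : {poly {poly K}}), ev1 s D != 0 /\ map_poly (ev1 s) Phi = ev1 s D *: chi.
Proof.
move=> sc.
have /choice [A /choice [B AB]] : forall i, exists A B,
  ev1 s B != 0 /\ chi`_i = ev1 s A / ev1 s B := sc.
pose n := size chi.
exists (\prod_(i < n) B i), (\poly_(i < n) (A i * \prod_(j < n | val j != i) B j)); split.
  by rewrite rmorph_prod; apply/prodf_neq0 => i _; case: (AB i).
apply/polyP => i; rewrite coef_map coefZ coef_poly; case: ltnP => [lt_i|le_i]; last first.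
  by rewrite [chi`_i]nth_default // mulr0; apply: rmorph0.
have [Bi ->] := AB i; rewrite [in RHS](bigD1 (Ordinal lt_i)) //= !rmorphM /=.
rewrite [RHS]mulrAC [ev1 s (B i) * _]mulrC divfK //.
Qed.

End Evaluation.

(** * Places above a point of the line *)

Section Reduction.
Context (K : numClosedFieldType) (F : fieldType) (iota : {rmorphism K -> F}).

Local Notation ev1 := (ev1 iota).
Local Notation ev2 := (ev2 iota).

(** Reduction modulo the inner variable, that is, restriction to s = 0. *)
Definition red : {poly {poly K}} -> {poly K} := map_poly (horner_eval 0).
HB.instance Definition _ := GRing.RMorphism.copy red (map_poly (horner_eval 0)).

Lemma redB : {morph red : A B / A - B}. Proof. exact: rmorphB. Qed.
Lemma redD : {morph red : A B / A + B}. Proof. exact: rmorphD. Qed.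
Lemma redM : {morph red : A B / A * B}. Proof. exact: rmorphM. Qed.
Lemma redC A : red A%:P = A.[0]%:P.
Proof. by rewrite /red map_polyC. Qed.
Lemma redX : red 'X = 'X.
Proof. by rewrite /red map_polyX. Qed.
Lemma coef_red Q i : (red Q)`_i = (Q`_i).[0].
Proof. by rewrite /red coef_map. Qed.

Lemma red_eq0 Q : red Q = 0 -> exists Q1, Q = 'X%:P * Q1.
Proof.
move=> Q0; exists (\poly_(i < size Q) (Q`_i %/ 'X)); apply/polyP => i.
rewrite coefCM coef_poly; case: ltnP => [_|le_i]; last by rewrite nth_default ?mulr0.
rewrite mulrC divpK // -[X in X %| _]subr0 -[X in _ - X]polyC0 dvdp_XsubCl /root.
by rewrite -coef_red Q0 coef0.
Qed.

Lemma red_primitive Q : Q != 0 -> exists m Q1, Q = ('X^m)%:P * Q1 /\ red Q1 != 0.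
Proof.
have [n] := ubnP (size (lead_coef Q)); elim: n Q => // n IH Q le_n Q0.
have [/red_eq0 [Q1 E]|r0] := eqVneq (red Q) 0; last by exists 0%N, Q; rewrite expr0 mul1r.
have Q10 : Q1 != 0 by apply: contraNneq Q0 => Q10; rewrite E Q10 mulr0.
have [|m [Q2 [E2 r2]]] := IH Q1 _ Q10.
  move: le_n; rewrite E lead_coefM lead_coefC mulrC size_mulX ?lead_coef_eq0 //.
exists m.+1, Q2; split=> //.
by rewrite E E2 mulrA -polyCM exprS.
Qed.

(** Gauss's lemma for the prime X of K[X]: reduction has values in a domain. *)
Lemma red_cancel m Q P R : red P != 0 -> ('X^m)%:P * R = Q * P ->
  exists Q1, Q = ('X^m)%:P * Q1.
Proof.
move=> rP; elim: m Q R => [|m IH] Q R E; first by exists Q; rewrite expr0 mul1r.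
have /red_eq0 [Q1 E1] : red Q = 0.
  apply/eqP; have := congr1 red E; rewrite !rmorphM /= redC hornerXn expr0n /= mul0r => /esym/eqP.
  by rewrite mulf_eq0 (negbTE rP) orbF.
have [|Q2 E2] := IH Q1 R.
  apply: (mulfI (_ : 'X%:P != 0)); first by rewrite polyC_eq0 polyX_eq0.
  by rewrite !mulrA -polyCM -exprS E E1.
by exists Q2; rewrite E1 E2 mulrA -polyCM -exprS.
Qed.

Context (s u : F).
Context (Phi : {poly {poly K}}).
Hypothesis Phi_min : forall R : {poly {poly K}}, (size R < size Phi)%N -> ev2 s u R = 0 -> R = 0.
Hypothesis Phi_red : red Phi != 0.
Hypothesis Phi_root : ev2 s u Phi = 0.

(** Phi generates the ideal of relations between s and u over the local ring of
    the s-line at 0: pseudo-division by Phi leaves no remainder, and the power of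
    X in the multiplier cancels because Phi is primitive at X. *)
Lemma local_gauss Psi : ev2 s u Psi = 0 ->
  exists d Q, d.[0] != 0 /\ d%:P * Psi = Q * Phi.
Proof.
move=> Psi0; have Phi0 : Phi != 0 by apply: contraNneq Phi_red => ->; rewrite rmorph0.
have E := Pdiv.Idomain.divp_eq Psi Phi.
have R0 : Psi %% Phi = 0.
  apply: Phi_min; first by rewrite Pdiv.Idomain.ltn_modp.
  have := congr1 (ev2 s u) E.
  by rewrite rmorphD rmorphM /= Phi_root mulr0 add0r -mul_polyC rmorphM /= Psi0 mulr0 => <-.
rewrite R0 addr0 -mul_polyC in E.
set a := lead_coef Phi ^+ _ in E.
have a0 : a != 0 by rewrite expf_neq0 // lead_coef_eq0.
have [m [d d0 ad]] := multiplicity_XsubC a 0.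
rewrite a0 /= in d0; rewrite polyC0 subr0 in ad.
have E' : ('X^m)%:P * (d%:P * Psi) = (Psi %/ Phi) * Phi.
  by rewrite -E ad mulrA -polyCM ['X^m * d]mulrC.
have [Q1 EQ] := red_cancel Phi_red E'.
exists d, Q1; split=> //.
apply: (mulfI (_ : ('X^m)%:P != 0)); first by rewrite polyC_eq0 expf_neq0 // polyX_eq0.
by rewrite E' EQ mulrA.
Qed.

(** A place of F above s = w = 0 exists as soon as s and w do not generate the
    unit ideal of K[s, w]. *)
Lemma exists_valuation_over (w : F) :
  ~ (exists A B, s * ev2 s w A + w * ev2 s w B = 1) ->
  exists V m, [/\ valuation_pair iota V m, m s & m w].
Proof.
move=> no1.
pose B0 y := exists A, y = ev2 s w A.
pose J0 y := exists A B, y = s * ev2 s w A + w * ev2 s w B.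
have iBJ : ideal_pair iota B0 J0.
  split.
  - by move=> c; exists c%:P%:P; rewrite ev2C ev1C.
  - by move=> _ _ [A ->] [B ->]; exists (A + B); rewrite rmorphD.
  - by move=> _ _ [A ->] [B ->]; exists (A * B); rewrite rmorphM.
  - move=> _ [A [B ->]]; exists ('X%:P * A + 'X * B).
    by rewrite rmorphD !rmorphM /= ev2C ev1X ev2X.
  - move=> _ _ [A [B ->]] [A' [B' ->]]; exists (A + A'), (B + B').
    by rewrite !rmorphD /=; ring.
  - move=> _ _ [C ->] [A [B ->]]; exists (C * A), (C * B).
    by rewrite !rmorphM /=; ring.
  - by move=> [A [B E]]; apply: no1; exists A, B.
have J00 : J0 0 by exists 0, 0; rewrite rmorph0 !mulr0 addr0.
have [V [m [vV lV lm]]] := exists_valuation_pair iBJ J00.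
exists V, m; split=> //; apply: lm.
- by exists 1, 0; rewrite rmorph0 rmorph1 mulr0 mulr1 addr0.
- by exists 0, 1; rewrite rmorph0 rmorph1 mulr0 mulr1 add0r.
Qed.

Lemma ev2_comp x y Q P : ev2 x y (Q \Po P) = ev2 x (ev2 x y P) Q.
Proof. by rewrite /ev2 /= map_comp_poly /horner_eval horner_comp. Qed.

(** A relation 1 = s A + (u - c) B would be a multiple of Phi up to a unit at 0,
    but it does not vanish at (0, c) whereas Phi does. *)
Lemma valuation_at_root c : root (red Phi) c ->
  exists V m, [/\ valuation_pair iota V m, m s & m (u - iota c)].
Proof.
move=> rc; apply: exists_valuation_over => -[A [B E]].
pose sh : {poly {poly K}} := 'X - c%:P%:P.
have evsh : ev2 s u sh = u - iota c by rewrite ev2B ev2X ev2C ev1C.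
have [|d [Q [d0]]] := @local_gauss ('X%:P * (A \Po sh) + sh * (B \Po sh) - 1).
  by rewrite ev2B ev2D !ev2M !ev2_comp rmorph1 ev2C ev1X evsh E subrr.
move=> /(congr1 red) /(congr1 (horner^~ c)) /eqP.
rewrite !redM redB redD !redM rmorph1 [red sh]redB redX !redC !hornerM hornerC (eqP rc) mulr0.
by rewrite !hornerE subrr !mul0r !add0r mulrN1 oppr_eq0 (negbTE d0).
Qed.

(** The analogue for the root at infinity: clearing denominators in a relation
    1 = s A + B / u gives a multiple of Phi whose reduction has full degree, while
    the degree of Phi drops under reduction. *)
Lemma valuation_at_pole : u != 0 -> (lead_coef Phi).[0] = 0 ->
  exists V m, [/\ valuation_pair iota V m, m s & m u^-1].
Proof.
move=> u0 lc0; apply: exists_valuation_over => -[A [B E]].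
(* rv N A is the reversed polynomial u^N A (s, 1/u). *)
pose rv N (A : {poly {poly K}}) := \sum_(i < size A) A`_i *: 'X^(N - i) : {poly {poly K}}.
have ev_rv N (A' : {poly {poly K}}) : (size A' <= N.+1)%N ->
    ev2 s u (rv N A') = u ^+ N * ev2 s u^-1 A'.
  move=> le_N; rewrite rmorph_sum ev2E mulr_sumr; apply: eq_bigr => i _.
  rewrite -mul_polyC rmorphM rmorphXn /= ev2C ev2X mulrCA; congr (_ * _).
  rewrite exprVn expfB_cond // (negbTE u0) add0n -ltnS.
  by apply: leq_trans le_N.
have sz_rv N (A' : {poly {poly K}}) : (size (rv N A') <= N.+1)%N.
  apply/leq_sizeP => j lt_j; rewrite coef_sum big1 // => i _; rewrite coefZ coefXn.
  by rewrite gtn_eqF ?mulr0 // (leq_ltn_trans (leq_subr _ _)).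
pose N := (size A + size B)%N.
pose Psi : {poly {poly K}} := 'X^(N.+1) - 'X%:P * rv N.+1 A - rv N B.
have Psi0 : ev2 s u Psi = 0.
  have szA : (size A <= N.+2)%N by rewrite /N; lia.
  have szB : (size B <= N.+1)%N by rewrite /N; lia.
  rewrite !ev2B ev2M rmorphXn /= ev2C ev1X ev2X !ev_rv //.
  transitivity (u ^+ N.+1 * (1 - (s * ev2 s u^-1 A + u^-1 * ev2 s u^-1 B))).
    by rewrite exprS; field.
  by rewrite E subrr mulr0.
have [d [Q [d0 EQ]]] := local_gauss Psi0.
have szPsi : (size Psi <= N.+2)%N.
  rewrite (leq_trans (size_polyD _ _)) // size_polyN geq_max (leq_trans (sz_rv _ _)) // andbT.
  rewrite (leq_trans (size_polyD _ _)) // size_polyN geq_max size_polyXn leqnn /=.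
  by rewrite mul_polyC (leq_trans (size_scale_leq _ _)).
have coefPsi : (red Psi)`_N.+1 = 1.
  rewrite coef_red /Psi !coefB coefXn eqxx coefCM !hornerD !hornerN hornerM hornerX.
  rewrite mul0r subr0.
  by rewrite hornerC [X in _ - X.[0]]nth_default ?horner0 ?subr0.
have Phi0 : Phi != 0 by apply: contraNneq Phi_red => ->; rewrite rmorph0.
have dP0 : d != 0 by apply: contraNneq d0 => ->; rewrite horner0.
have Psi_neq0 : Psi != 0.
  by apply/eqP => P0; move/eqP: coefPsi; rewrite P0 rmorph0 coef0 eq_sym oner_eq0.
have Q0 : Q != 0.
  apply: contraTneq (mulf_neq0 (_ : d%:P != 0) Psi_neq0); rewrite ?polyC_eq0 //.
  by move=> Q0; rewrite EQ Q0 mul0r negbK.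
have szQ : ((size Q + size Phi).-1 <= N.+2)%N.
  by rewrite -size_mul // -EQ mul_polyC (leq_trans (size_scale_leq _ _)).
have szr : (size (red Q * red Phi)%R <= N.+1)%N.
  have rQ : (size (red Q) <= size Q)%N by apply: size_poly.
  have rP : (size (red Phi) < size Phi)%N.
    have -> : size Phi = (size Phi).-1.+1 by rewrite prednK // lt0n size_poly_eq0.
    rewrite ltnS; apply/leq_sizeP => j; rewrite leq_eqVlt => /orP [/eqP <-|lt_j].
      by rewrite coef_red.
    by rewrite coef_red nth_default ?horner0 //; apply: leq_trans (leqSpred _) lt_j.
  apply: leq_trans (size_polyMleq _ _) _; move: rQ rP szQ.
  move: (size (red Q)) (size (red Phi)) (size Q) (size Phi) => a b c d'; lia.
have := congr1 (fun q => (red q)`_N.+1) EQ.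
rewrite /= !rmorphM /= redC coefCM coefPsi mulr1 [RHS]nth_default // => /eqP.
by rewrite (negbTE d0).
Qed.

End Reduction.

(** * Traces and the residue theorem for a simple pole *)

Section Trace.
Context (K : numClosedFieldType) (F : fieldType) (iota : {rmorphism K -> F}).

Local Notation ev1 := (ev1 iota).
Local Notation ev2 := (ev2 iota).

Lemma ev1_horner_mod (B J : F -> Prop) (BJ : ideal_pair iota B J) u c A :
  J (u - iota c) -> J (ev1 u A - iota A.[c]).
Proof.
move=> Jw; have := ev1_mod BJ (A \Po ('X + c%:P)) Jw.
by rewrite ev1_comp ev1D ev1X ev1C subrK horner_comp !hornerE.
Qed.

Lemma ev2_mod (B J : F -> Prop) (BJ : ideal_pair iota B J) s u c Q :
  J s -> J (u - iota c) -> J (ev2 s u Q - iota (red Q).[c]).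
Proof.
move=> Js Jw; rewrite -(subrK (ev1 u (red Q)) (ev2 s u Q)) -addrA.
apply: (pair_addI BJ); last exact: (ev1_horner_mod BJ).
have Bu : B u.
  rewrite -(subrK (iota c) u).
  by apply: (pair_add BJ); [apply: (pair_sub BJ)|apply: (pair_cst BJ)].
have -> : ev1 u (red Q) = \sum_(i < size Q) iota (Q`_i).[0] * u ^+ i.
  rewrite ev1E (big_ord_widen (size Q) (fun i => iota (red Q)`_i * u ^+ i)) ?size_poly //.
  rewrite big_mkcond; apply: eq_bigr => i _; rewrite -coef_red; case: ltnP => // le_i.
  by rewrite nth_default // rmorph0 mul0r.
rewrite ev2E -sumrB; elim/big_ind: _ => [||i _]; first exact: (pair_0I BJ Js).
  exact: (pair_addI BJ).
rewrite -mulrBl; apply: (pair_mulIr BJ); first exact: (ev1_mod BJ).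
exact: (pair_exp BJ).
Qed.

Context (T : Type) (O m : T -> F -> Prop).
Hypothesis places : forall P, valuation_pair iota (O P) (m P).
Hypothesis complete : forall V mV, valuation_pair iota V mV ->
  (exists2 s, s != 0 & mV s) -> exists P, forall y, mV y -> m P y.

(** The coefficient of chi here is minus the trace of u.  Each root of the reduction
    of a primitive equation of u, including infinity when the degree drops, is
    the value of u at some place above s = 0, hence 0 or c; so the trace has the
    value b c at s = 0, where b is the multiplicity of the root c. *)
Lemma trace_regular s u c chi : transcendental iota s -> minimal_poly iota s u chi ->
  (forall P, m P s -> m P u \/ m P (u - iota c)) ->
  exists A B b, [/\ B.[0] != 0, chi`_(size chi).-2 * ev1 s B = ev1 s A,
    A.[0] = - (c *+ b) * B.[0]
    & forall P, m P s -> m P (u - iota c) -> (0 < b)%N].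
Proof.
move=> ts mchi hu; have szchi := minimal_poly_size mchi.
have [mon sc ru mn] := mchi.
have s0 : s != 0.
  apply/eqP => s0; have /ts /eqP : ev1 s 'X = 0 by rewrite ev1X.
  by rewrite polyX_eq0.
have [D [Phi0 [D0 EPhi0]]] := clear_denominators sc.
have chi0 : chi != 0 by apply: monic_neq0.
have Phi00 : Phi0 != 0.
  apply/eqP => P0; move/eqP: EPhi0; rewrite P0 rmorph0 eq_sym scaler_eq0.
  by rewrite (negbTE D0) (negbTE chi0).
have [k [Phi [EPhi rPhi]]] := red_primitive Phi00.
have sz_map Q : size (map_poly (ev1 s) Q) = size Q.
  have [->|Q0] := eqVneq Q 0; first by rewrite rmorph0 !size_poly0.
  by rewrite size_map_poly_id0 // transcendental_eq0 // lead_coef_eq0.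
pose e := ev1 s D / s ^+ k.
have e0 : e != 0 by rewrite mulf_neq0 // invr_eq0 expf_neq0.
have Echi : map_poly (ev1 s) Phi = e *: chi.
  have sk0 : s ^+ k != 0 by rewrite expf_neq0.
  apply: (scalerI sk0); rewrite scalerA /e mulrCA mulfV // mulr1 -EPhi0 EPhi rmorphM /=.
  by rewrite map_polyC /= mul_polyC rmorphXn /= ev1X.
have szPhi : size Phi = size chi by rewrite -sz_map Echi size_scale.
have Phi_root : ev2 s u Phi = 0.
  by rewrite /ev2 /= Echi /horner_eval hornerZ (eqP ru) mulr0.
have Phi_min (R : {poly {poly K}}) : (size R < size Phi)%N -> ev2 s u R = 0 -> R = 0.
  move=> lt_R Rsu; apply/eqP/negP => /negP R0.
  have : (size chi <= size (map_poly (ev1 s) R))%N.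
    apply: mn; last by rewrite /root; apply/eqP.
      by rewrite -size_poly_eq0 sz_map size_poly_eq0.
    by move=> i; rewrite coef_map; apply: rational_ev1.
  by rewrite sz_map -szPhi leqNgt lt_R.
set a0 := lead_coef Phi.
have Ea0 : ev1 s a0 = e.
  rewrite /a0 lead_coefE -coef_map Echi coefZ szPhi.
  by rewrite -lead_coefE (eqP mon) mulr1.
(* Otherwise u has a pole above s = 0. *)
have a00 : a0.[0] != 0.
  apply/eqP => a00; have [u0|u0] := eqVneq u 0.
    have : (size chi <= 2)%N.
      have := mn 'X; rewrite size_polyX; apply; rewrite ?polyX_eq0 //.
      - by move=> i; rewrite coefX; case: eqP => _; [apply: rational1|apply: rational0].
      - by rewrite /root hornerX u0.
    move=> le2; have sz2 : size Phi = 2%N by apply/eqP; rewrite szPhi eqn_leq le2.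
    move/eqP: rPhi; apply; apply/polyP => -[|[|i]]; rewrite coef_red coef0.
    - suff -> : Phi`_0 = 0 by rewrite horner0.
      apply: ts; have := Phi_root; rewrite ev2E sz2 !big_ord_recl big_ord0 /= u0.
      by rewrite expr0 mulr1 exprS mul0r mulr0 !addr0.
    - by move: a00; rewrite /a0 lead_coefE sz2.
    - by rewrite nth_default ?horner0 // sz2.
  have [V [mV [vV ms mu]]] := valuation_at_pole Phi_min rPhi Phi_root u0 a00.
  have [P lP] := complete vV (ex_intro2 _ _ s s0 ms).
  have Pu : m P u^-1 := lP _ mu.
  have Ou : O P u.
    case: (hu P (lP _ ms)) => [|h]; first exact: (pair_sub (places P)).
    rewrite -(subrK (iota c) u); apply: (pair_add (places P)).
      exact: (pair_sub (places P)).
    exact: (pair_cst (places P)).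
  by case: (pair_proper (places P)); rewrite -(mulfV u0); apply: (pair_mulI (places P)).
have root_values z : root (red Phi) z -> z = 0 \/ z = c.
  move=> rz; have [V [mV [vV ms mu]]] := valuation_at_root Phi_min rPhi Phi_root rz.
  have [P lP] := complete vV (ex_intro2 _ _ s s0 ms).
  have Pu := lP _ mu; case: (hu P (lP _ ms)) => h; [left|right].
    apply: (pair_cstI (places P)); rewrite -[iota z](subKr u).
    exact: (pair_subI (places P)).
  apply/eqP; rewrite -subr_eq0; apply/eqP; apply: (pair_cstI (places P)).
  have -> : iota (z - c) = (u - iota c) - (u - iota z) by rewrite rmorphB; ring.
  exact: (pair_subI (places P)).
have szr : size (red Phi) = size chi.
  rewrite -szPhi; apply/eqP; rewrite eqn_leq size_poly /= leqNgt.
  apply/negP => lt; move/eqP: a00; apply; rewrite /a0 lead_coefE -coef_red nth_default //.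
  by rewrite -ltnS prednK // szPhi ltnW.
have lcr : lead_coef (red Phi) = a0.[0].
  by rewrite lead_coefE szr -szPhi coef_red.
have [r Er] := closed_field_poly_normal (red Phi).
have szr' : size r = (size chi).-1.
  by rewrite -szr Er size_scale ?lead_coef_eq0 // size_prod_XsubC.
exists Phi`_(size chi).-2, a0, (count_mem c r); split=> //.
- by rewrite Ea0 -coef_map Echi coefZ mulrC.
- rewrite -coef_red Er coefZ -szr' coefPn_prod_XsubC; last first.
    by rewrite szr' -lt0n -ltnS prednK // ltnW.
  rewrite lcr mulrC; congr (- _ * _).
  rewrite -sum1_count -sumrMnr [RHS]big_mkcond /= big_seq [RHS]big_seq.
  apply: eq_bigr => z zr; case: eqVneq => [->|nz] //.
  have : root (red Phi) z by rewrite Er rootZ ?lead_coef_eq0 // root_prod_XsubC.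
  by case/root_values => // zc; rewrite zc eqxx in nz.
- move=> P ms mu; rewrite -has_count has_pred1 -root_prod_XsubC.
  rewrite -(rootZ _ _ (_ : lead_coef (red Phi) != 0)) ?lead_coef_eq0 // -Er.
  apply/eqP; apply: (pair_cstI (places P)); have := ev2_mod (places P) Phi ms mu.
  by rewrite Phi_root sub0r => /(pair_oppI (places P)); rewrite opprK.
Qed.

(** At a pole of x each factor x - z of A (x) has an inverse in the local ring. *)
Lemma ev1_infinity P x A : x != 0 -> m P x^-1 -> A != 0 -> O P (ev1 x A)^-1.
Proof.
move=> x0 mx A0; have [r ->] := closed_field_poly_normal A.
rewrite -mul_polyC rmorphM rmorph_prod /= ev1C invfM -prodfV.
apply: (pair_mul (places P)); first by rewrite -fmorphV; apply: (pair_cst (places P)).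
apply: (pair_prod (places P)) => z _; rewrite ev1B ev1X ev1C.
have -> : x - iota z = x * (1 - iota z * x^-1) by rewrite mulrBr mulr1 mulrCA mulfV // mulr1.
have mz : m P (iota z * x^-1).
  by apply: (pair_mulI (places P)) => //; apply: (pair_cst (places P)).
rewrite invfM; apply: (pair_mul (places P)); first exact: (pair_sub (places P)).
apply: (local_inv (places P)).
  by apply: (pair_subr (places P)); [apply: (pair_1 (places P))|apply: (pair_sub (places P))].
move=> h; apply: (pair_proper (places P)); rewrite -(subrK (iota z * x^-1) 1).
exact: (pair_addI (places P)).
Qed.

(** By tameness, the two hypotheses on all P say that f dx is regular away from p;
    the residue at p is - e c, where e is the order of the pole of x.  The trace of
    f is regular at every finite a, hence a polynomial in x, so x times it cannot
    have at infinity a finite nonzero value; but its value there is a positive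
    multiple of c. *)
Lemma single_log_residue_eq0 (trdeg1 : forall a b, transcendental iota a ->
    exists2 Q : {poly {poly K}}, Q != 0 & ev2 a b Q = 0) x f p c :
  transcendental iota x ->
  (forall P a, m P (x - iota a) -> m P ((x - iota a) * f)) ->
  (forall P, P <> p -> m P x^-1 -> m P (x * f)) ->
  m p x^-1 -> m p (x * f - iota c) -> c = 0.
Proof.
move=> tx f_fin f_inf px pf; apply/eqP/negP => /negP c0.
have x0 : x != 0.
  apply/eqP => x0; have /tx /eqP : ev1 x 'X = 0 by rewrite ev1X.
  by rewrite polyX_eq0.
have [Q Q0 Qxf] := trdeg1 x f tx.
have [chi mchi] := exists_minimal_poly tx Q0 Qxf.
have szchi := minimal_poly_size mchi; have [mon sc _ _] := mchi.
have sz_scaled lam : size (\poly_(i < size chi) (chi`_i * lam ^+ ((size chi).-1 - i))) = size chi.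
  by rewrite size_poly_eq // subnn mulr1 -lead_coefE (eqP mon) oner_eq0.
have coef_scaled lam :
    (\poly_(i < size chi) (chi`_i * lam ^+ ((size chi).-1 - i)))`_(size chi).-2 =
    chi`_(size chi).-2 * lam.
  rewrite coef_poly; case: (size chi) szchi => [|[|k]] //= _.
  by rewrite ltnS leqnSn subSnn.
set beta := chi`_(size chi).-2 in coef_scaled.
have tsh a : transcendental iota (x - iota a).
  move=> A; have -> : x - iota a = ev1 x ('X - a%:P) by rewrite ev1B ev1X ev1C.
  rewrite -ev1_comp => /tx /eqP; rewrite -size_poly_eq0 size_comp_poly2 ?size_XsubC //.
  by rewrite size_poly_eq0 => /eqP.
(* Each root a of a denominator of beta cancels, by the local statement at a. *)
have beta_poly n (A B : {poly K}) : (size B <= n)%N -> B != 0 -> beta * ev1 x B = ev1 x A ->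
    exists A', beta = ev1 x A'.
  elim: n A B => [|n IH] A B; first by rewrite leqn0 size_poly_eq0 => /eqP ->; rewrite eqxx.
  move=> szB B0 E; have [/size_poly1P [b b0 Eb]|szB1] := boolP (size B == 1%N).
    exists (b^-1 *: A); rewrite -mul_polyC rmorphM /= ev1C -E Eb ev1C mulrCA -rmorphM.
    by rewrite mulVf // rmorph1 mulr1.
  have [a Ba] := closed_rootP _ szB1.
  have Ex : x - iota a = ev1 x ('X - a%:P) by rewrite ev1B ev1X ev1C.
  have sa : rational iota x (x - iota a) by rewrite [X in rational _ _ X]Ex; apply: rational_ev1.
  have sx : rational iota (x - iota a) x.
    rewrite -{2}(subrK (iota a) x); apply: rationalD; [apply: rational_gen|exact: rational_cst].
  have xa0 : x - iota a != 0 by rewrite Ex transcendental_eq0 ?polyXsubC_eq0.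
  have mchi' := minimal_poly_rational sx sa (minimal_poly_scale sa xa0 mchi).
  have hu P : m P (x - iota a) -> m P ((x - iota a) * f) \/ m P ((x - iota a) * f - iota 0).
    by move=> h; left; apply: f_fin.
  have [A' [B' [b [B'0 E' A'0 _]]]] := trace_regular (tsh a) mchi' hu.
  rewrite sz_scaled coef_scaled in E'.
  have /factor_theorem [A2 EA2] : root A' 0 by rewrite /root A'0 mul0rn oppr0 mul0r.
  have E2 : beta * ev1 (x - iota a) B' = ev1 (x - iota a) A2.
    apply: (mulIf xa0); rewrite mulrAC E' EA2 polyC0 subr0 rmorphM /= ev1X //.
  rewrite Ex -!ev1_comp in E2.
  have EP : A * (B' \Po ('X - a%:P)) = (A2 \Po ('X - a%:P)) * B.
    by apply: (transcendental_inj tx); rewrite !rmorphM /= -E -E2; ring.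
  have Aa : root A a.
    have := congr1 (horner^~ a) EP; rewrite !hornerM !horner_comp !hornerE subrr (eqP Ba) mulr0.
    by move=> /eqP; rewrite mulf_eq0 (negbTE B'0) orbF.
  have /factor_theorem [A1 EA1] := Aa; have /factor_theorem [B1 EB1] := Ba.
  have B10 : B1 != 0 by apply: contraNneq B0 => h; rewrite EB1 h mul0r.
  apply: (IH A1 B1) => //.
    by move: szB; rewrite EB1 size_Mmonic ?monicXsubC // size_XsubC addn2.
  apply: (mulIf xa0); rewrite Ex -mulrA -!rmorphM /= -EA1 -EB1 //.
have [A0 [B0 [B00 Eb]]] := sc (size chi).-2.
have [A EA] : exists A', beta = ev1 x A'.
  apply: (@beta_poly (size B0) A0 B0) => //.
    by apply: contraNneq B00 => ->; rewrite rmorph0.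
  by rewrite /beta Eb divfK.
(* At infinity the local parameter of the line is 1/x. *)
have tV : transcendental iota x^-1.
  apply: not_cst_transcendental => d xd.
  have /tx /eqP : ev1 x ('X - d^-1%:P) = 0.
    by rewrite ev1B ev1X ev1C fmorphV -xd invrK subrr.
  by rewrite polyXsubC_eq0.
have xV : rational iota x x^-1 by apply: rationalV; apply: rational_gen.
have Vx : rational iota x^-1 x by rewrite -{2}(invrK x); apply: rationalV; apply: rational_gen.
have mchi' :=
  minimal_poly_rational Vx xV (minimal_poly_scale (rational_gen iota x) x0 mchi).
have hu P : m P x^-1 -> m P (x * f) \/ m P (x * f - iota c).
  by move=> h; case: (pselect (P = p)) => [->|/f_inf]; [right|left; auto].
have [A' [B' [b [B'0 E' A'0 bpos]]]] := trace_regular tV mchi' hu.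
rewrite sz_scaled coef_scaled in E'.
have b0 := bpos p px pf.
have A'00 : A'.[0] != 0 by rewrite A'0 mulf_neq0 // oppr_eq0 mulrn_eq0 negb_or c0 -lt0n b0.
have uA := ev1_unit (places p) px A'00.
have uB := ev1_unit (places p) px B'0.
have An0 : A != 0.
  apply/eqP => h; apply: uA; rewrite -E' EA h rmorph0 !mul0r; exact: (pair_0I (places p) px).
have B'n0 : ev1 x^-1 B' != 0.
  by apply/eqP => h; apply: uB; rewrite h; apply: (pair_0I (places p) px).
have Ox : O p x.
  have -> : x = ev1 x^-1 A' * (ev1 x^-1 B')^-1 * (ev1 x A)^-1.
    rewrite -E' mulfK // EA mulrAC mulfV ?mul1r //.
    by rewrite transcendental_eq0.
  apply: (pair_mul (places p)); last exact: ev1_infinity.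
  have OV A1 : O p (ev1 x^-1 A1).
    by apply: (ev1_closed (places p)); apply: (pair_sub (places p)).
  by apply: (pair_mul (places p)) => //; apply: (local_inv (places p)).
by apply: (pair_proper (places p)); rewrite -(mulfV x0); apply: (pair_mulI (places p)).
Qed.

End Trace.

(** * Derivations and discrete valuation rings *)

Section Derivations.
Context (K : numClosedFieldType) (F : fieldType) (iota : {rmorphism K -> F}).

Local Notation ev1 := (ev1 iota).
Local Notation ev2 := (ev2 iota).

Definition cst_derivation (d : F -> F) : Prop :=
  [/\ forall f h, d (f + h) = d f + d h,
      forall f h, d (f * h) = d f * h + f * d h
    & forall z, d (iota z) = 0].

Lemma natr_neq0 n : (n.+1%:R : F) != 0.
Proof. by rewrite -(rmorph_nat iota) fmorph_eq0 pnatr_eq0. Qed.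

Section OneDerivation.
Context (d : F -> F) (dd : cst_derivation d).

Lemma derD f h : d (f + h) = d f + d h. Proof. by case: dd. Qed.
Lemma derM f h : d (f * h) = d f * h + f * d h. Proof. by case: dd. Qed.
Lemma derC z : d (iota z) = 0. Proof. by case: dd. Qed.
Lemma der0 : d 0 = 0. Proof. by have := derC 0; rewrite rmorph0. Qed.
Lemma der1 : d 1 = 0. Proof. by have := derC 1; rewrite rmorph1. Qed.
Lemma der_inv f : f != 0 -> d f^-1 = - (d f / f ^+ 2).
Proof.
move=> f0; apply: (mulfI f0); apply: (addrI (d f / f)).
by rewrite -derM mulfV // der1; field.
Qed.

Lemma der_exp f n : d (f ^+ n.+1) = n.+1%:R * f ^+ n * d f.
Proof.
elim: n => [|n IH]; first by rewrite expr1 expr0 !mul1r.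
by rewrite exprS derM IH -[n.+2%:R]natr1 [f ^+ n.+1]exprS; ring.
Qed.

Lemma der_expz f (k : int) : f != 0 -> d (f ^ k) = k%:~R * (f ^ k / f) * d f.
Proof.
move=> f0; case: k => [[|n]|n].
- by rewrite expr0z der1 !mul0r.
- by rewrite -exprnP der_exp pmulrn exprSr mulfK.
- rewrite NegzE -exprnN der_inv ?expf_neq0 // der_exp mulrNz -pmulrn.
  by rewrite [f ^+ n.+1]exprS; field; rewrite f0 expf_neq0.
Qed.

Lemma der_horner (p : {poly F}) y :
  d p.[y] = (map_poly d p).[y] + p^`().[y] * d y.
Proof.
elim/poly_ind: p => [|p c IH].
  by rewrite map_poly0 deriv0 !hornerE der0.
have -> : map_poly d (p * 'X + c%:P) = map_poly d p * 'X + (d c)%:P.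
  apply/polyP => i; rewrite coef_map_id0 ?der0 // !coefD !coefMX !coefC coef_map_id0 ?der0 //.
  by case: i => [|i]; rewrite ?add0r ?addr0.
rewrite derivMXaddC !hornerE derD derM IH; ring.
Qed.

Lemma der_rational s y : d s = 0 -> rational iota s y -> d y = 0.
Proof.
move=> ds; have E A : d (ev1 s A) = 0.
  elim/poly_ind: A => [|p c IH]; first by rewrite rmorph0 der0.
  by rewrite ev1D ev1M ev1X ev1C derD derM IH ds derC mul0r mulr0 !addr0.
by move=> [A [B [B0 ->]]]; rewrite derM der_inv // !E !mul0r oppr0 mulr0 addr0.
Qed.

Hypothesis trdeg1 : forall a b, transcendental iota a ->
  exists2 Q : {poly {poly K}}, Q != 0 & ev2 a b Q = 0.

(** Apply d to the minimal polynomial of y over K(x): its coefficients are killed,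
    and its derivative does not vanish at y in characteristic zero. *)
Lemma der_eq0 x y : transcendental iota x -> d x = 0 -> d y = 0.
Proof.
move=> tx dx; have [Q Q0 Qxy] := trdeg1 y tx.
have [chi mchi] := exists_minimal_poly tx Q0 Qxy.
have szchi := minimal_poly_size mchi; have [mon sc ry mn] := mchi.
have := der_horner chi y; rewrite (eqP ry) der0.
have -> : map_poly d chi = 0.
  by apply/polyP => i; rewrite coef_map_id0 ?der0 // coef0; apply: der_rational (sc i).
rewrite horner0 add0r => /esym/eqP; rewrite mulf_eq0 => /orP [r'|/eqP //].
have chi'0 : chi^`() != 0.
  apply/eqP => /(congr1 (fun q : {poly F} => q`_(size chi).-2)); rewrite coef_deriv coef0.
  rewrite prednK; last by rewrite -ltnS prednK // ltnW.
  rewrite -lead_coefE (eqP mon) => /eqP; case: (size chi) szchi => [|[|k]] //= _.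
  by rewrite (negbTE (natr_neq0 k)).
have : (size chi <= size chi^`())%N.
  apply: mn => // i; rewrite coef_deriv -mulr_natr; apply: rationalM => //.
  by rewrite -(rmorph_nat iota); apply: rational_cst.
by rewrite leqNgt lt_size_deriv // monic_neq0.
Qed.

End OneDerivation.

(** Derivations of F over K form a space of dimension at most one: the combination
    d(a) e - e(a) d kills a. *)
Lemma der_proportional (trdeg1 : forall a b, transcendental iota a ->
    exists2 Q : {poly {poly K}}, Q != 0 & ev2 a b Q = 0) d e a b :
  cst_derivation d -> cst_derivation e -> d a * e b = d b * e a.
Proof.
move=> dd de.
case: (pselect (exists c, a = iota c)) => [[c ->]|na].
  by rewrite (derC dd) (derC de) mul0r mulr0.
have ta : transcendental iota a by apply: not_cst_transcendental => c ac; apply: na; exists c.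
pose D f := d a * e f - e a * d f.
have dD : cst_derivation D.
  split=> [f h|f h|z]; rewrite /D.
  - by rewrite (derD dd) (derD de); ring.
  - by rewrite (derM dd) (derM de); ring.
  - by rewrite (derC dd) (derC de) !mulr0 subrr.
have /eqP : D b = 0 by apply: (der_eq0 dD trdeg1 (x := a)) => //; rewrite /D mulrC subrr.
by rewrite subr_eq0 => /eqP ->; rewrite mulrC.
Qed.

End Derivations.

Section DiscreteValuation.
Context (K : numClosedFieldType) (F : fieldType) (iota : {rmorphism K -> F}).

Local Notation ev1 := (ev1 iota).
Local Notation ev2 := (ev2 iota).

Hypothesis trdeg1 : forall a b : F, b != 0 ->
  exists Q : {poly {poly K}}, Q`_0 != 0 /\ ev2 a b Q = 0.

Context (O m : F -> Prop) (Om : local_pair iota O m).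
Hypothesis residue : forall f, O f -> exists c, m (f - iota c).
Hypothesis fraction : forall f, exists a b, [/\ O a, O b, b != 0 & f = a / b].

Definition unit_of (f : F) := O f /\ ~ m f.

Context (t : F) (t0 : t != 0) (mt : m t).
Hypothesis mE : forall f, m f -> exists2 u, O u & f = u * t.

Lemma unit_neq0 u : unit_of u -> u != 0.
Proof. by move=> [_ mu]; apply/eqP => u0; apply: mu; rewrite u0; apply: (pair_0I Om mt). Qed.

Lemma unitM u v : unit_of u -> unit_of v -> unit_of (u * v).
Proof.
move=> [Ou mu] [Ov mv]; split; first exact: (pair_mul Om).
by move=> /(local_prime Om Ou Ov) [].
Qed.

Lemma unitV u : unit_of u -> unit_of u^-1.
Proof. by move=> [Ou mu]; split; [apply: (local_inv Om)|apply: (local_inv_notI Om)]. Qed.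

Lemma unit_cst c : c != 0 -> unit_of (iota c).
Proof.
move=> c0; split; first exact: (pair_cst Om).
by move=> /(pair_cstI Om) h; rewrite h eqxx in c0.
Qed.

Lemma unit_addI u a : unit_of u -> m a -> unit_of (u + a).
Proof.
move=> [Ou mu] ma; split; first by apply: (pair_add Om) => //; apply: (pair_sub Om).
by move=> h; apply: mu; rewrite -(addrK a u); apply: (pair_subI Om).
Qed.

(** An algebraic relation Q (t, f) = 0 with Q (t, 0) <> 0 shows that f divides a
    power of t up to a unit, which bounds the powers of t dividing f. *)
Lemma factor_integral f : O f -> f != 0 -> exists u n, unit_of u /\ f = u * t ^+ n.
Proof.
move=> Of f0.
have [Q [Q0 Qtf]] := trdeg1 t f0.
have [k nk] : exists k, ~ exists2 u, O u & f = u * t ^+ k.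
  have [k [q q0 EQ]] := multiplicity_XsubC Q`_0 0.
  rewrite Q0 polyC0 subr0 /= in q0 EQ.
  exists k.+1 => -[u Ou fu].
  have [Q1] := ev2_split iota t f Q.
  rewrite Qtf EQ ev1M rmorphXn /= ev1X {2}fu exprS => /esym E.
  have Of1 : O (ev2 t f Q1).
    rewrite ev2E; apply: (pair_sum Om) => i _; apply: (pair_mul Om).
      by apply: (ev1_closed Om); apply: (pair_sub Om).
    exact: (pair_exp Om).
  apply: (ev1_unit Om mt (_ : q.[0] != 0)) => //.
  have -> : ev1 t q = - (ev2 t f Q1 * u) * t.
    apply: (mulIf (expf_neq0 k t0)); apply/eqP; rewrite -subr_eq0; apply/eqP.
    by rewrite -[RHS]E fu exprS; ring.
  apply: (pair_mulI Om) => //; apply: (pair_opp Om); exact: (pair_mul Om).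
elim: k nk => [|k IH] nk; first by case: nk; exists f; rewrite ?expr0 ?mulr1.
case: (pselect (exists2 u, O u & f = u * t ^+ k)) => // -[u Ou fu].
exists u, k; split=> //; split=> // mu; apply: nk.
by have [v Ov uv] := mE mu; exists v; rewrite // fu uv exprS mulrA.
Qed.

Lemma factor_uniformizer f : f != 0 -> exists u (k : int), unit_of u /\ f = u * t ^ k.
Proof.
have [a [b [Oa Ob b0 ->]]] := fraction f => ab0.
have a0 : a != 0 by apply: contraNneq ab0 => ->; rewrite mul0r.
have [u [n [Uu ->]]] := factor_integral Oa a0.
have [v [l [Uv ->]]] := factor_integral Ob b0.
exists (u / v), (n%:Z - l%:Z); split; first by apply: unitM => //; apply: unitV.
by rewrite expfzDr // -invr_expz -!exprnP invfM mulrACA.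
Qed.

Lemma unit_expz_lt u (k : int) : unit_of u -> 0 < k -> m (u * t ^ k).
Proof.
case: k => [[|n]|n] // [Ou _] _; rewrite -exprnP exprS mulrCA.
apply: (pair_mulIr Om) => //; apply: (pair_mul Om) => //.
by apply: (pair_exp Om); apply: (pair_sub Om).
Qed.

Lemma ord_unique u v (k l : int) : unit_of u -> unit_of v -> u * t ^ k = v * t ^ l -> k = l.
Proof.
wlog le_kl : u v k l / k <= l.
  move=> W Uu Uv E; have [h|/ltW h] := lerP k l; first exact: (W u v).
  by apply/esym; apply: (W v u).
move=> Uu Uv E; apply/eqP; rewrite eq_le le_kl /= leNgt; apply/negP => lt_kl.
apply: Uu.2; have -> : u = v * t ^ (l - k).
  by rewrite expfzDr // -invr_expz mulrA -E mulfK // expfz_neq0.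
by apply: unit_expz_lt; rewrite ?subr_gt0.
Qed.

Lemma dvr_total : valuation_pair iota O m.
Proof.
split=> // f f0; have [u [k [Uu fu]]] := factor_uniformizer f0.
have pos v (n : nat) : unit_of v -> O (v * t ^+ n).
  by move=> [Ov _]; apply: (pair_mul Om) => //; apply: (pair_exp Om); apply: (pair_sub Om).
case: k fu => n ->; [left|right]; first exact: pos.
by rewrite NegzE -exprnN invfM invrK; apply: pos; apply: unitV.
Qed.

Section DerivationAtPoint.
Context (d : F -> F) (dd : cst_derivation iota d) (dt : d t = 1).
Hypothesis bounded : exists N, forall f, O f -> O (t ^+ N * d f).

(** Writing f = c + t u gives d(f) = u + t d(u), so a bound N.+1 on the order of
    the poles improves to N. *)
Lemma der_integral f : O f -> O (d f).
Proof.
have [N] := bounded; elim: N f => [|N IH] f HN Of; first by rewrite -(mul1r (d f)); apply: HN.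
apply: IH => // h Oh; have [c /mE [u Ou Eu]] := residue Oh.
have -> : d h = u + t * d u.
  have -> : h = iota c + t * u by rewrite mulrC -Eu addrC subrK.
  by rewrite (derD dd) (derM dd) (derC dd) dt add0r mul1r.
rewrite mulrDr mulrA -exprSr; apply: (pair_add Om); last exact: HN.
by apply: (pair_mul Om) => //; apply: (pair_exp Om); apply: (pair_sub Om).
Qed.

(** The logarithmic derivative of y = u t^k is k / t plus a regular term, and k is
    invertible in characteristic zero: this is tameness of the ramification. *)
Lemma der_nonunit y : y != 0 -> ~ unit_of y -> exists2 v, unit_of v & d y = v * (y / t).
Proof.
move=> y0 nUy; have [u [k [Uu yu]]] := factor_uniformizer y0.
have k0 : k != 0 by apply/eqP => k0; apply: nUy; rewrite yu k0 expr0z mulr1.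
have u0 := unit_neq0 Uu.
exists (iota k%:~R + t * (d u / u)).
  apply: unit_addI; first by apply: unit_cst; rewrite intr_eq0.
  apply: (pair_mulIr Om) => //; apply: (pair_mul Om); first exact: der_integral Uu.1.
  exact: (unitV Uu).1.
rewrite yu (derM dd) (der_expz dd) // dt rmorph_int mulr1.
by field; rewrite u0 t0.
Qed.

End DerivationAtPoint.
End DiscreteValuation.

(** * The local rings of a projective curve *)
Section ValuationResidue.
Context (K : numClosedFieldType) (F : fieldType) (iota : {rmorphism K -> F}).

Hypothesis trdeg1 : forall a b : F, b != 0 ->
  exists Q : {poly {poly K}}, Q`_0 != 0 /\ ev2 iota a b Q = 0.

(** The residue field of a nontrivial place is K: a relation between y and s, not
    divisible by s, gives a nonzero polynomial over K vanishing at the residue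
    of y, and K is algebraically closed. *)
Lemma local_residue (V m : F -> Prop) (Vm : local_pair iota V m) s y :
  s != 0 -> m s -> V y -> exists c, m (y - iota c).
Proof.
move=> s0 ms Vy; have [Q [Q0 Qys]] := trdeg1 y s0.
have : m (ev1 iota y Q`_0).
  have [Q1 /esym/eqP] := ev2_split iota y s Q; rewrite Qys addrC addr_eq0 => /eqP ->.
  apply: (pair_oppI Vm); apply: (pair_mulI Vm) => //.
  rewrite ev2E; apply: (pair_sum Vm) => i _; apply: (pair_mul Vm).
    exact: (ev1_closed Vm).
  by apply: (pair_exp Vm); apply: (pair_sub Vm).
have [r Er] := closed_field_poly_normal Q`_0.
rewrite Er -mul_polyC ev1M ev1C rmorph_prod /=.
have Vz z : V (ev1 iota y ('X - z%:P)) by apply: (ev1_closed Vm).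
case/(local_prime Vm); first exact: (pair_cst Vm).
- by apply: (pair_prod Vm) => z _.
- by move=> /(pair_cstI Vm) /eqP; rewrite lead_coef_eq0 (negbTE Q0).
elim: r {Er} => [|z r IH]; first by rewrite big_nil => /(pair_proper Vm).
rewrite big_cons; case/(local_prime Vm) => //.
  by apply: (pair_prod Vm) => z' _.
by rewrite ev1B ev1X ev1C => h; exists z.
Qed.

End ValuationResidue.

Lemma mmap_homog n (A B : comNzRingType) (f : {rmorphism A -> B}) (h : 'I_n -> B)
    (c : B) d (G : {mpoly A[n]}) :
  G \is d.-homog -> mmap f (fun i => c * h i) G = c ^+ d * mmap f h G.
Proof.
move=> /dhomogP hG; rewrite /mmap mulr_sumr; apply: eq_big_seq => mm /hG dm.
rewrite mulrCA; congr (_ * _); rewrite -dm /mmap1.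
under eq_bigr do rewrite exprMn.
by rewrite big_split /= prodrXr mdegE.
Qed.

Lemma homog_cross n (A : comNzRingType) d d' (G H G' H' : {mpoly A[n]}) :
  G \is d.-homog -> H \is d.-homog -> G' \is d'.-homog -> H' \is d'.-homog ->
  G * H' + G' * H \is (d + d').-homog.
Proof.
by move=> hG hH hG' hH'; apply: dhomogD; [|rewrite addnC]; apply: dhomogM.
Qed.

Lemma bivariate_of_mpoly (A : idomainType) (B : comNzRingType) (f : {rmorphism A -> B})
   (e : {rmorphism {poly {poly A}} -> B}) (a b : B) (Q : {mpoly A[2]}) :
  (forall c, e c%:P%:P = f c) -> e 'X%:P = a -> e 'X = b ->
  Q != 0 -> mmap f (fun i : 'I_2 => if i == ord0 then a else b) Q = 0 ->
  exists2 P : {poly {poly A}}, P != 0 & e P = 0.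
Proof.
move=> ec ea eb Q0 Qab.
pose mon (mm : 'X_{1..2}) : {poly {poly A}} :=
  (Q@_mm)%:P%:P * (('X^(mm ord0))%:P * 'X^(mm (fintype.lift ord0 ord0))).
exists (\sum_(mm <- msupp Q) mon mm); last first.
  rewrite rmorph_sum -[RHS]Qab; apply: eq_bigr => mm _.
  rewrite /mon !rmorphM /= ec; congr (_ * _).
  by rewrite /mmap1 !big_ord_recl big_ord0 /= mulr1 !rmorphXn /= ea eb.
have coef_mon mm i j : (mon mm)`_j`_i =
    Q@_mm * (i == mm ord0)%:R * (j == mm (fintype.lift ord0 ord0))%:R.
  by rewrite /mon !coefCM coefXn; case: (j == _); rewrite ?mulr1 ?mulr0 ?coef0 ?coefXn ?mulr0.
apply/eqP => S0; case: (msupp Q) (msupp_eq0 Q) (msupp_uniq Q) (mcoeff_msupp Q) S0.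
  by rewrite eqxx (negbTE Q0).
move=> mm r _ /= /andP [nr _] hs S0.
have : Q@_mm != 0 by rewrite -hs mem_head.
have := congr1 (fun P : {poly {poly A}} => P`_(mm (fintype.lift ord0 ord0))`_(mm ord0)) S0.
rewrite big_cons /= !coefD coef0 coef_sum coef0 coef_sum coef_mon !eqxx !mulr1.
rewrite big1_seq ?addr0 => [->|mm' /= mr]; first by rewrite eqxx.
rewrite coef_mon; case: eqP => E1; rewrite ?mulr0 ?mul0r //.
case: eqP => E2; rewrite ?mulr0 //; case/negP: nr.
suff -> : mm = mm' by [].
apply/mnmP => i; case: (unliftP ord0 i) => [j ->|-> //].
by rewrite (ord1 j).
Qed.

Section CurvePoints.
Context (R : realType) (C : proj_curve R).

Local Notation n := (adim C).
Local Notation F := (ratfun C).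
Local Notation K := R[i].
Local Notation form := {mpoly K[n.+1]}.
Local Notation cst := (cst C).
Local Notation gen := (@gen R C).
Local Notation evF := (mmap cst gen).

(** Transcendence degree at most one, in the form of a relation that is nontrivial
    on b = 0. *)
Lemma curve_relation (a b : F) : b != 0 ->
  exists Q : {poly {poly K}}, Q`_0 != 0 /\ ev2 cst a b Q = 0.
Proof.
move=> b0; have [Q Q0 Qab] := trdeg_le1 (fun i : 'I_2 => if i == ord0 then a else b).
have [|||P P0 Pab] := @bivariate_of_mpoly _ _ cst (ev2 cst a b) a b Q _ _ _ Q0 Qab.
- by move=> c; rewrite /= ev2C ev1C.
- by rewrite /= ev2C ev1X.
- by rewrite /= ev2X.
have [k [q]] := multiplicity_XsubC P 0.
rewrite P0 /root horner_coef0 polyC0 subr0 /= => q0 EP; exists q; split=> //.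
move: Pab => /=; rewrite EP ev2M rmorphXn /= ev2X => /eqP.
by rewrite mulf_eq0 (negbTE (expf_neq0 k b0)) orbF => /eqP.
Qed.

Lemma curve_trdeg1 (a b : F) : transcendental cst a ->
  exists2 Q : {poly {poly K}}, Q != 0 & ev2 cst a b Q = 0.
Proof.
move=> ta; have [->|b0] := eqVneq b 0.
  by exists 'X; rewrite ?polyX_eq0 ?ev2X.
have [Q [Q0 Qab]] := curve_relation a b0; exists Q => //.
by apply: contraNneq Q0 => ->; rewrite coef0.
Qed.

Lemma point_vector (P : point C) : exists2 v, v \in line P & v != 0.
Proof.
have [/asboolP [dim1 _]] : `[< on_curve (line P) >] by case: P.
exists (vpick (line P)); first exact: memv_pick.
by rewrite vpick0; apply: contra_eq_neq dim1 => ->; rewrite dimv0.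
Qed.

Section AtPoint.
Context (P : point C) (v : 'rV[K]_n.+1) (vP : v \in line P) (v0 : v != 0).

Lemma homog_scale (G : form) d c (w : 'rV[K]_n.+1) : G \is d.-homog ->
  G.@[(c *: w) ord0] = c ^+ d * G.@[w ord0].
Proof.
move=> hG; rewrite /meval -(mmap_homog idfun _ _ hG).
by apply: eq_bigr => mm _; congr (_ * _); apply: mmap1_eq => i; rewrite mxE.
Qed.

Lemma vanishing_at_vector (G : form) d : G \is d.-homog -> evF G = 0 -> G.@[v ord0] = 0.
Proof.
move=> hG G0; have [/asboolP [_ h]] : `[< on_curve (line P) >] by case: (P).
by apply: h vP; split=> //; exists d.
Qed.

Lemma zero_atE (G : form) d : G \is d.-homog -> zero_at P G <-> G.@[v ord0] = 0.
Proof.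
move=> hG; split=> [|Gv w wP]; first by apply.
have : line P = <[v]>%VS.
  have [/asboolP [dim1 _]] : `[< on_curve (line P) >] by case: (P).
  apply/esym/eqP; rewrite eqEdim dim1 dim_vline v0 andbT.
  by rewrite -memvE.
move=> LP; move: wP; rewrite LP => /vlineP [c ->].
by rewrite (homog_scale _ _ hG) Gv mulr0.
Qed.

Lemma nonvanishing_gen (H : form) d : H \is d.-homog -> H.@[v ord0] != 0 -> evF H != 0.
Proof. by move=> hH; apply: contra_neq => /(vanishing_at_vector hH). Qed.

Lemma local_ringE f : local_ring P f <-> exists d (G H : form),
  [/\ G \is d.-homog, H \is d.-homog, H.@[v ord0] != 0 & f = evF G / evF H].
Proof.
split=> [[G [H [[d hG hH] nH ->]]]|[d [G [H [hG hH nH ->]]]]].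
  by exists d, G, H; split=> //; apply/eqP => h; apply: nH; apply/(zero_atE hH).
by exists G, H; split=> //; [exists d|move=> /(zero_atE hH)/eqP; apply/negP].
Qed.

Lemma local_maxE f : local_max P f <-> exists d (G H : form),
  [/\ G \is d.-homog, H \is d.-homog, H.@[v ord0] != 0, G.@[v ord0] = 0 & f = evF G / evF H].
Proof.
split=> [[G [H [[[d hG hH] nH ->] zG]]]|[d [G [H [hG hH nH zG ->]]]]].
  exists d, G, H; split=> //; last exact/(zero_atE hG).
  by apply/eqP => h; apply: nH; apply/(zero_atE hH).
exists G, H; split; last exact/(zero_atE hG).
by split=> //; [exists d|move=> /(zero_atE hH)/eqP; apply/negP].
Qed.

Lemma gen_coordinate i : v ord0 i != 0 -> gen i != 0.
Proof.
move=> vi; have hX : ('X_i : form) \is 1.-homog by rewrite dhomogX /= mdeg1.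
by have := nonvanishing_gen hX; rewrite mevalXU => /(_ vi); rewrite mmapX mmap1U.
Qed.

Lemma curve_local_pair_at : local_pair cst (local_ring P) (local_max P).
Proof.
have h1 : (1 : form) \is 0.-homog by apply: dhomog1.
have ev1F : evF 1 = 1 by rewrite rmorph1.
split; first split.
- move=> c; apply/local_ringE; exists 0%N, (c *: 1), 1; split=> //.
  + by rewrite dhomogZ.
  + by rewrite rmorph1 oner_eq0.
  + by rewrite mmapZ ev1F mulr1 divr1.
- move=> a b /local_ringE [d [G [H [hG hH nH ->]]]].
  move=> /local_ringE [d' [G' [H' [hG' hH' nH' ->]]]].
  apply/local_ringE; exists (d + d')%N, (G * H' + G' * H), (H * H'); split.
  + exact: homog_cross.
  + by rewrite dhomogM.
  + by rewrite mevalM mulf_neq0.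
  + by rewrite rmorphD !rmorphM /= addf_div ?(nonvanishing_gen hH) ?(nonvanishing_gen hH').
- move=> a b /local_ringE [d [G [H [hG hH nH ->]]]].
  move=> /local_ringE [d' [G' [H' [hG' hH' nH' ->]]]].
  apply/local_ringE; exists (d + d')%N, (G * G'), (H * H'); split; rewrite ?dhomogM //.
  + by rewrite mevalM mulf_neq0.
  + by rewrite !rmorphM /= mulf_div.
- move=> a /local_maxE [d [G [H [hG hH nH _ ->]]]].
  by apply/local_ringE; exists d, G, H.
- move=> a b /local_maxE [d [G [H [hG hH nH Gv ->]]]].
  move=> /local_maxE [d' [G' [H' [hG' hH' nH' Gv' ->]]]].
  apply/local_maxE; exists (d + d')%N, (G * H' + G' * H), (H * H'); split.
  + exact: homog_cross.
  + by rewrite dhomogM.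
  + by rewrite mevalM mulf_neq0.
  + by rewrite mevalD !mevalM Gv Gv' !mul0r addr0.
  + by rewrite rmorphD !rmorphM /= addf_div ?(nonvanishing_gen hH) ?(nonvanishing_gen hH').
- move=> a b /local_ringE [d [G [H [hG hH nH ->]]]].
  move=> /local_maxE [d' [G' [H' [hG' hH' nH' Gv' ->]]]].
  apply/local_maxE; exists (d + d')%N, (G * G'), (H * H'); split; rewrite ?dhomogM //.
  + by rewrite mevalM mulf_neq0.
  + by rewrite mevalM Gv' mulr0.
  + by rewrite !rmorphM /= mulf_div.
- move=> /local_maxE [d [G [H [hG hH nH Gv /esym/divr1_eq E]]]].
  have hGH : G - H \is d.-homog by rewrite dhomogD // dhomogN.
  have := vanishing_at_vector hGH; rewrite rmorphB /= E subrr mevalB Gv sub0r => /(_ erefl) /eqP.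
  by rewrite oppr_eq0 (negbTE nH).
- move=> a /local_ringE [d [G [H [hG hH nH ->]]]] nm.
  apply/local_ringE; exists d, H, G; split=> //; last by rewrite invf_div.
  by apply/eqP => Gv; apply: nm; apply/local_maxE; exists d, G, H.
Qed.

Lemma curve_residue_at f : local_ring P f -> exists c, local_max P (f - cst c).
Proof.
move=> /local_ringE [d [G [H [hG hH nH ->]]]]; exists (G.@[v ord0] / H.@[v ord0]).
apply/local_maxE; exists d, (G - (G.@[v ord0] / H.@[v ord0]) *: H), H; split=> //.
- by rewrite dhomogD // dhomogN dhomogZ.
- by rewrite mevalB mevalZ divfK // subrr.
- by rewrite rmorphB /= mmapZ mulrBl mulfK // (nonvanishing_gen hH).
Qed.

Lemma vector_coordinate : exists i, v ord0 i != 0.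
Proof.
apply/existsP; apply: contraNT v0; rewrite negb_exists => /forallP h.
by apply/eqP/rowP => i; rewrite mxE; apply/eqP; move: (h i); rewrite negbK.
Qed.

Lemma local_ring_affine i G d : v ord0 i != 0 -> G \is d.-homog ->
  local_ring P (evF G / gen i ^+ d).
Proof.
move=> vi hG; apply/local_ringE; exists d, G, ('X_i ^+ d); split=> //.
- have hX : ('X_i : form) \is 1.-homog by rewrite dhomogX /= mdeg1.
  by have := dhomogMn d hX; rewrite mul1n.
- by rewrite rmorphXn /= mevalXU expf_neq0.
- by rewrite rmorphXn /= mmapX mmap1U.
Qed.

Lemma curve_fraction_at f : exists a b,
  [/\ local_ring P a, local_ring P b, b != 0 & f = a / b].
Proof.
have [i vi] := vector_coordinate; have gi := gen_coordinate vi.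
have [d [G [H [hG hH H0 ->]]]] := gen_ratfun f.
exists (evF G / gen i ^+ d), (evF H / gen i ^+ d); split.
- exact: local_ring_affine.
- exact: local_ring_affine.
- by rewrite mulf_neq0 // invr_eq0 expf_neq0.
- by rewrite invf_div mulrA divfK // expf_neq0.
Qed.

Lemma evF_affine i d (G : form) : G \is d.-homog -> gen i != 0 ->
  evF G / gen i ^+ d = mmap cst (fun j => gen j / gen i) G.
Proof.
move=> hG gi; rewrite mulrC -exprVn -(mmap_homog cst _ _ hG).
by apply: eq_bigr => mm _; congr (_ * _); apply: mmap1_eq => j; rewrite mulrC.
Qed.

End AtPoint.

Lemma curve_local_pair (P : point C) : local_pair cst (local_ring P) (local_max P).
Proof. by have [v vP v0] := point_vector P; apply: curve_local_pair_at vP v0. Qed.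

Lemma curve_residue (P : point C) (f : F) : local_ring P f -> exists c, local_max P (f - cst c).
Proof. by have [v vP v0] := point_vector P; apply: curve_residue_at vP v0 _. Qed.

Lemma curve_fraction (P : point C) (f : F) : exists a b,
  [/\ local_ring P a, local_ring P b, b != 0 & f = a / b].
Proof. by have [v vP v0] := point_vector P; apply: curve_fraction_at vP v0 _. Qed.

Lemma local_unitE (P : point C) (f : F) :
  local_unit P f <-> unit_of (local_ring P) (local_max P) f.
Proof.
have [v vP v0] := point_vector P; split=> [[G [H [Gf nG]]]|[[G [H Gf]] nm]].
  split; first by exists G, H.
  case: Gf => -[d hG hH] nH -> /(local_maxE vP v0) [d' [G' [H' [hG' hH' nH' G'v E]]]].
  apply: nG; apply/(zero_atE vP v0 hG).
  have {}nH : H.@[v ord0] != 0 by apply/eqP => h; apply: nH; apply/(zero_atE vP v0 hH).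
  have hD : G * H' - G' * H \is (d + d').-homog.
    by rewrite -mulNr; apply: homog_cross; rewrite ?dhomogN.
  have := vanishing_at_vector vP hD.
  rewrite rmorphB !rmorphM /= mevalB !mevalM G'v mul0r subr0 => h.
  have /eqP : G.@[v ord0] * H'.@[v ord0] = 0.
    apply: h; apply/eqP; rewrite subr_eq0 -eqr_div ?E //.
      exact: nonvanishing_gen vP _ _ hH nH.
    exact: nonvanishing_gen vP _ _ hH' nH'.
  by rewrite mulf_eq0 (negbTE nH') orbF => /eqP.
exists G, H; split=> // zG; apply: nm; by exists G, H.
Qed.

End CurvePoints.

(** * Centers of valuations on a projective curve *)
Section Center.
Context (R : realType) (C : proj_curve R).

Local Notation n := (adim C).
Local Notation F := (ratfun C).
Local Notation K := R[i].
Local Notation form := {mpoly K[n.+1]}.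
Local Notation cst := (cst C).
Local Notation gen := (@gen R C).
Local Notation evF := (mmap cst gen).

Context (V m : F -> Prop) (Vm : valuation_pair cst V m).
Context (s : F) (s0 : s != 0) (ms : m s).

(** Projectivity enters here: V being a valuation ring, some homogeneous coordinate
    has minimal valuation. *)
Lemma dominant_coordinate : exists2 i, gen i != 0 & forall j, V (gen j / gen i).
Proof.
suff [i gi hi] : exists2 i, gen i != 0 & forall j, j \in enum 'I_n.+1 -> V (gen j / gen i).
  by exists i => // j; apply: hi; rewrite mem_enum.
elim: (enum _) => [|x r [i gi hi]]; first by have [i gi] := gen_neq0 C; exists i.
case: (pselect (V (gen x / gen i))) => [Vx|nV].
  by exists i => // j; rewrite inE => /orP [/eqP ->|/hi].
have xi0 : gen x / gen i != 0 by apply/eqP => E; apply: nV; rewrite E; apply: (pair_0 Vm).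
have x0 : gen x != 0 by apply: contraNneq xi0 => ->; rewrite mul0r.
have Vi : V (gen i / gen x) by case: (valuation_total Vm xi0) => //; rewrite invf_div.
exists x => // j; rewrite inE => /orP [/eqP ->|/hi Vj].
  by rewrite mulfV //; apply: (pair_1 Vm).
have -> : gen j / gen x = (gen j / gen i) * (gen i / gen x) by rewrite mulrA divfK.
exact: (pair_mul Vm).
Qed.

Lemma mmap_residue (y : 'I_n.+1 -> F) (c : 'I_n.+1 -> K) (G : form) :
  (forall j, V (y j)) -> (forall j, m (y j - cst (c j))) ->
  m (mmap cst y G - cst (mmap idfun c G)).
Proof.
move=> Vy myc; pose near (f : F) (z : K) := V f /\ m (f - cst z).
have m0 : m 0 by apply: (pair_0I Vm ms).
have near_cst z : near (cst z) z by split; rewrite ?subrr //; apply: (pair_cst Vm).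
have near_mul f z f' z' : near f z -> near f' z' -> near (f * f') (z * z').
  move=> [Vf mf] [Vf' mf']; split; first exact: (pair_mul Vm).
  have -> : f * f' - cst (z * z') = (f - cst z) * f' + cst z * (f' - cst z').
    by rewrite rmorphM; ring.
  apply: (pair_addI Vm); first exact: (pair_mulIr Vm).
  by apply: (pair_mulI Vm) => //; apply: (pair_cst Vm).
have near_add f z f' z' : near f z -> near f' z' -> near (f + f') (z + z').
  move=> [Vf mf] [Vf' mf']; split; first exact: (pair_add Vm).
  have -> : f + f' - cst (z + z') = (f - cst z) + (f' - cst z') by rewrite rmorphD; ring.
  exact: (pair_addI Vm).
suff [_ //] : near (mmap cst y G) (mmap idfun c G).
have near0 : near 0 0 by have := near_cst 0; rewrite rmorph0.
have near1 : near 1 1 by have := near_cst 1; rewrite rmorph1.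
apply: (big_ind2 near) => // mm _; apply: (near_mul) => //=.
apply: (big_ind2 near) => // j _; elim: (mm j) => [|k IH]; rewrite ?expr0 // !exprS.
by apply: near_mul; first by split.
Qed.

(** The residues of the affine coordinates in V are the coordinates of a point of
    the curve, and V dominates its local ring. *)
Lemma exists_center : exists P : point C,
  (forall f, local_ring P f -> V f) /\ (forall f, local_max P f -> m f).
Proof.
have [i0 gi0 Vy] := dominant_coordinate.
have /choice [c mc] : forall j, exists c, m (gen j / gen i0 - cst c).
  by move=> j; apply: (local_residue (@curve_relation R C) Vm s0 ms).
have ci0 : c i0 = 1.
  apply/eqP; rewrite eq_sym -subr_eq0; apply/eqP; apply: (pair_cstI Vm).
  by rewrite rmorphB rmorph1 /= -(mulfV gi0).
pose v : 'rV[K]_n.+1 := \row_j c j.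
have v0 : v != 0.
  apply/eqP => /rowP /(_ i0) /eqP; by rewrite !mxE ci0 oner_eq0.
have meval_v (G : form) : G.@[v ord0] = mmap idfun c G.
  by apply: eq_bigr => mm _; congr (_ * _); apply: mmap1_eq => j; rewrite mxE.
have res (G : form) d : G \is d.-homog -> m (evF G / gen i0 ^+ d - cst (G.@[v ord0])).
  by move=> hG; rewrite (evF_affine hG gi0) meval_v; apply: mmap_residue.
have Vaff (G : form) d : G \is d.-homog -> V (evF G / gen i0 ^+ d).
  move=> hG; rewrite -(subrK (cst (G.@[v ord0])) (_ / _)).
  by apply: (pair_add Vm); [apply: (pair_sub Vm); apply: res|apply: (pair_cst Vm)].
have onv : `[< on_curve (C := C) <[v]>%VS >].
  apply/asboolP; split; first by rewrite dim_vline v0.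
  move=> G [[d hG] G0] w /vlineP [k ->]; rewrite (homog_scale _ _ hG).
  suff -> : G.@[v ord0] = 0 by rewrite mulr0.
  apply: (pair_cstI Vm); have := res G d hG; rewrite G0 mul0r sub0r.
  by move=> /(pair_oppI Vm); rewrite opprK.
pose P : point C := Point onv.
have vP : v \in line P by apply: memv_line.
have Vfrac (G H : form) d : G \is d.-homog -> H \is d.-homog -> H.@[v ord0] != 0 ->
    V (evF G / evF H) /\ (G.@[v ord0] = 0 -> m (evF G / evF H)).
  move=> hG hH nH; have -> : evF G / evF H = (evF G / gen i0 ^+ d) * (evF H / gen i0 ^+ d)^-1.
    by rewrite invf_div mulrA divfK // expf_neq0.
  have VH : V (evF H / gen i0 ^+ d)^-1.
    apply: (local_inv Vm); first exact: Vaff.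
    move=> mH; move/eqP: nH; apply; apply: (pair_cstI Vm).
    rewrite -[cst _](subKr (evF H / gen i0 ^+ d)); apply: (pair_subI Vm) => //; exact: res.
  split; first by apply: (pair_mul Vm) => //; apply: Vaff.
  move=> G0; apply: (pair_mulIr Vm) => //.
  by have := res G d hG; rewrite G0 rmorph0 subr0.
exists P; split=> f.
- by move=> /(local_ringE vP v0) [d [G [H [hG hH nH ->]]]]; apply: (Vfrac G H d hG hH nH).1.
- by move=> /(local_maxE vP v0) [d [G [H [hG hH nH Gv ->]]]]; apply: (Vfrac G H d hG hH nH).2.
Qed.

End Center.

(** * Orders of functions and differentials *)
Section Order.
Context (R : realType) (C : proj_curve R).

Local Notation n := (adim C).
Local Notation F := (ratfun C).
Local Notation K := R[i].
Local Notation cst := (cst C).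
Local Notation gen := (@gen R C).
Local Notation Lp := (@curve_local_pair R C).
Local Notation rel := (@curve_relation R C).

Section AtPoint.
Context (P : point C).

Let unitMP u v := @unitM K F cst _ _ (Lp P) u v.

Lemma uniformizer_ratio t t' : uniformizer P t -> t != 0 -> uniformizer P t' -> t' != 0 ->
  exists2 w, unit_of (local_ring P) (local_max P) w & t' = w * t.
Proof.
move=> [mt ut] t0 [mt' ut'] t'0; have [w Ow E] := ut _ mt'; have [w' Ow' E'] := ut' _ mt.
exists w => //; split=> // mw.
have ww : w' * w = 1 by apply: (mulIf t0); rewrite mul1r -mulrA -E -E'.
by apply: (pair_proper (Lp P)); rewrite -ww; apply: (pair_mulI (Lp P)).
Qed.

Lemma unit_expz u (k : int) : unit_of (local_ring P) (local_max P) u ->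
  unit_of (local_ring P) (local_max P) (u ^ k).
Proof.
move=> Uu; have U1 : unit_of (local_ring P) (local_max P) 1.
  by split; [apply: (pair_1 (Lp P))|apply: (pair_proper (Lp P))].
have Un l : unit_of (local_ring P) (local_max P) (u ^+ l).
  by elim: l => [|l IH]; rewrite ?expr0 ?exprS //; apply: unitMP.
case: k => l; first exact: Un.
by rewrite NegzE -exprnN; apply: (unitV (Lp P)).
Qed.

(** The order does not depend on the uniformizer. *)
Lemma ord_at_rebase t f k : uniformizer P t -> t != 0 -> ord_at P f k ->
  exists2 u, unit_of (local_ring P) (local_max P) u & f = u * t ^ k.
Proof.
move=> ut t0 [t' [u [ut' /local_unitE Uu t'0 ->]]].
have [w Uw ->] := uniformizer_ratio ut t0 ut' t'0.
exists (u * w ^ k); last by rewrite expfzMl mulrA.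
by apply: unitMP => //; apply: unit_expz.
Qed.

Lemma ord_at_intro t u k : uniformizer P t -> t != 0 ->
  unit_of (local_ring P) (local_max P) u -> ord_at P (u * t ^ k) k.
Proof. by move=> ut t0 Uu; exists t, u; split=> //; apply/local_unitE. Qed.

Lemma ord_at_uniq f k l : ord_at P f k -> ord_at P f l -> k = l.
Proof.
move=> [t [u [ut /local_unitE Uu t0 E]]] /(ord_at_rebase ut t0) [v Uv E'].
by apply: (ord_unique (Lp P) t0 ut.1 Uu Uv); rewrite -E.
Qed.

Lemma ord_at_neq0 f k : ord_at P f k -> f != 0.
Proof.
move=> [t [u [ut /local_unitE Uu t0 ->]]].
by rewrite mulf_neq0 ?expfz_neq0 // (unit_neq0 (Lp P) ut.1 Uu).
Qed.

Lemma ord_atM f h k l : ord_at P f k -> ord_at P h l -> ord_at P (f * h) (k + l).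
Proof.
move=> [t [u [ut /local_unitE Uu t0 ->]]] /(ord_at_rebase ut t0) [v Uv ->].
by rewrite mulrACA -expfzDr //; apply: ord_at_intro => //; apply: unitMP.
Qed.

Lemma ord_atV f k : ord_at P f k -> ord_at P f^-1 (- k).
Proof.
move=> [t [u [ut /local_unitE Uu t0 ->]]]; rewrite invfM invr_expz.
by apply: ord_at_intro => //; apply: (unitV (Lp P)).
Qed.

Lemma ord_at_unit f u k : ord_at P f k -> unit_of (local_ring P) (local_max P) u -> ord_at P u 0.
Proof.
by move=> [t [_ [ut _ t0 _]]] Uu; rewrite -[u]mulr1 -(expr0z t); apply: ord_at_intro.
Qed.

Lemma ord_at_cst f k c : ord_at P f k -> c != 0 -> ord_at P (cst c) 0.
Proof. by move=> Pf c0; apply: (ord_at_unit Pf); apply: (unit_cst (Lp P)). Qed.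

Lemma ord_at_max f k : ord_at P f k -> 0 < k -> local_max P f.
Proof. by move=> [t [u [ut /local_unitE Uu t0 ->]]]; apply: (unit_expz_lt (Lp P) ut.1). Qed.

Lemma uniformizer_dvr t : uniformizer P t -> t != 0 ->
  valuation_pair cst (local_ring P) (local_max P).
Proof. by move=> ut t0; apply: (dvr_total rel (Lp P) (@curve_fraction R C P) t0 ut.1 ut.2). Qed.

Section Derivation.
Context (t : F) (ut : uniformizer P t) (d : F -> F) (dd : derivation d) (dt : d t = 1).

Lemma local_parameter_neq0 : t != 0.
Proof.
apply/eqP => t0; have := dt; rewrite t0 (der0 (dd : cst_derivation cst d)) => /esym/eqP.
by rewrite oner_eq0.
Qed.

Let t0 := local_parameter_neq0.
Let D : cst_derivation cst d := dd.

(** The local ring is a localization of the algebra generated by the finitely many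
    affine coordinates, so the poles of their derivatives bound all others. *)
Lemma derivation_bounded : exists N, forall f, local_ring P f -> local_ring P (t ^+ N * d f).
Proof.
have L := Lp P.
have Ot : local_ring P t by apply: (pair_sub L); exact: ut.1.
have pole f : exists N, local_ring P (t ^+ N * d f).
  have [->|df0] := eqVneq (d f) 0; first by exists 0%N; rewrite mulr0; apply: (pair_0 L).
  have [u [k [[Ou _] ->]]] := factor_uniformizer rel L (@curve_fraction R C P) t0 ut.1 ut.2 df0.
  exists `|k|%N; rewrite mulrCA; apply: (pair_mul L) => //.
  case: k => l; first by rewrite -exprnP -exprD; apply: (pair_exp L).
  by rewrite NegzE abszN absz_nat -exprnN mulfV ?expf_neq0 //; apply: (pair_1 L).
have [v vP v0] := point_vector P.
have [i0 vi0] := vector_coordinate v0; have gi0 := gen_coordinate vP vi0.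
pose y j := gen j / gen i0.
have /choice [e He] : forall j, exists N, local_ring P (t ^+ N * d (y j)).
  by move=> j; apply: pole.
pose N := (\sum_j e j)%N.
exists N.
pose W f := local_ring P f /\ local_ring P (t ^+ N * d f).
have W_cst c : W (cst c).
  by split; [apply: (pair_cst L)|rewrite (derC D) mulr0; apply: (pair_0 L)].
have W_add f h : W f -> W h -> W (f + h).
  move=> [Of Wf] [Oh Wh]; split; first exact: (pair_add L).
  by rewrite (derD D) mulrDr; apply: (pair_add L).
have W_mul f h : W f -> W h -> W (f * h).
  move=> [Of Wf] [Oh Wh]; split; first exact: (pair_mul L).
  rewrite (derM D) mulrDr mulrA mulrCA.
  by apply: (pair_add L); apply: (pair_mul L).
have W_y j : W (y j).
  split.
    have hX : ('X_j : {mpoly K[n.+1]}) \is 1.-homog by rewrite dhomogX /= mdeg1.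
    by have := local_ring_affine vP v0 vi0 hX; rewrite mmapX mmap1U expr1.
  rewrite /N (bigD1 j) //= addnC exprD -mulrA; apply: (pair_mul L) => //.
  exact: (pair_exp L).
have W_exp f k : W f -> W (f ^+ k).
  move=> Wf; elim: k => [|k IH]; first by rewrite expr0 -(rmorph1 cst).
  by rewrite exprS; apply: W_mul.
have W_form (G : {mpoly K[n.+1]}) : W (mmap cst y G).
  apply: big_ind => [||mm _]; [by rewrite -(rmorph0 cst)|exact: W_add|].
  apply: (W_mul) => //; apply: big_ind => [||j _]; [by rewrite -(rmorph1 cst)|exact: W_mul|].
  exact: W_exp.
have W_inv f : f != 0 -> local_ring P f^-1 -> W f -> W f^-1.
  move=> f0 Of' [Of Wf]; split=> //.
  rewrite (der_inv D) // mulrN; apply: (pair_opp L).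
  by rewrite mulrA -exprVn; apply: (pair_mul L) => //; apply: (pair_exp L).
move=> f /(local_ringE vP v0) [k [G [H [hG hH nH ->]]]].
have HH : mmap cst gen H / gen i0 ^+ k = mmap cst y H by apply: (evF_affine hH).
have -> : mmap cst gen G / mmap cst gen H = mmap cst y G * (mmap cst y H)^-1.
  by rewrite -(evF_affine hG gi0) -HH invf_div mulrA divfK // expf_neq0.
apply: (W_mul _ _ _ _).2 => //; apply: W_inv => //.
- by rewrite -HH mulf_neq0 ?invr_eq0 ?expf_neq0 // (nonvanishing_gen vP hH).
- rewrite -HH invf_div; apply/(local_ringE vP v0); exists k, ('X_i0 ^+ k), H; split=> //.
    have hX : ('X_i0 : {mpoly K[n.+1]}) \is 1.-homog by rewrite dhomogX /= mdeg1.
    by have := dhomogMn k hX; rewrite mul1n.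
  by rewrite rmorphXn /= mmapX mmap1U.
Qed.

Lemma derivation_integral f : local_ring P f -> local_ring P (d f).
Proof.
by apply: (der_integral (Lp P) (@curve_residue R C P) ut.1 ut.2 D dt derivation_bounded).
Qed.

(** The differential f dy has order k at P exactly when f y, the coefficient of
    dy / y, has order k + 1, since dy / y has a simple pole where y has a zero or
    a pole. *)
Lemma ord_log_differential f y k : y != 0 -> ~ unit_of (local_ring P) (local_max P) y ->
  ord_at P (f * d y) k -> ord_at P (f * y) (k + 1).
Proof.
move=> y0 nUy ofy.
have [v Uv Ev] := der_nonunit rel (Lp P) (@curve_residue R C P) (@curve_fraction R C P)
  t0 ut.1 ut.2 D dt derivation_bounded y0 nUy.
have [u Uu Eu] := ord_at_rebase ut t0 ofy.
have v0 := unit_neq0 (Lp P) ut.1 Uv.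
have -> : f * y = (u / v) * t ^ (k + 1).
  rewrite expfzDr // expr1z; apply: (mulIf v0).
  have -> : f * y * v = f * d y * t by rewrite Ev; field; exact: t0.
  by rewrite Eu; field; exact: v0.
by apply: ord_at_intro => //; apply: unitMP => //; apply: (unitV (Lp P)).
Qed.

End Derivation.
End AtPoint.

Hypothesis regular : forall P : point C, exists t d,
  [/\ uniformizer P t, derivation d & d t = 1].

Lemma curve_valuation P : valuation_pair cst (local_ring P) (local_max P).
Proof.
have [t [d [ut dd dt]]] := regular P.
exact: uniformizer_dvr ut (local_parameter_neq0 dd dt).
Qed.

(** The local ring of the center is a valuation ring, and a valuation ring that
    dominates another one is equal to it. *)
Lemma curve_complete V m : valuation_pair cst V m -> (exists2 s, s != 0 & m s) ->
  exists P : point C, forall y, m y -> local_max P y.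
Proof.
move=> Vm [s s0 ms]; have [P [OV mm]] := exists_center Vm s0 ms.
exists P => y my; have LP := curve_valuation P.
have [->|y0] := eqVneq y 0.
  have [t [d [[mt _] _ _]]] := regular P; exact: (pair_0I LP mt).
have nOV : ~ local_ring P y^-1 by move=> /OV Vy; apply: (pair_unit_notI Vm y0 Vy my).
have Oy : local_ring P y by case: (valuation_total LP y0).
case: (pselect (local_max P y)) => // nm; case: nOV; exact: (local_inv LP).
Qed.

(** A coordinate x with a pole at p is h itself or 1 / (h - a), and f is changed
    accordingly. *)
Theorem no_single_simple_pole (f h : F) (p : point C) :
  (forall P, P <> p -> exists2 k, 0 <= k & ord_diff_at P f h k) ->
  ord_diff_at p f h (-1) -> False.
Proof.
move=> hreg [t [d [ut dd dt op]]].
have Lv := curve_valuation.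
have th : transcendental cst h.
  apply: not_cst_transcendental => c hc; move: (ord_at_neq0 op).
  by rewrite hc (derC (dd : cst_derivation cst d)) mulr0 eqxx.
(* The differentials f' dx and f dh coincide. *)
have [x [f' [tx nOx Ef]]] : exists x f', [/\ transcendental cst x, ~ local_ring p x
    & forall e, derivation e -> f' * e x = f * e h].
  case: (pselect (local_ring p h)) => [Oh|nOh]; last by exists h, f.
  have [a ma] := curve_residue Oh.
  have ha0 : h - cst a != 0.
    apply/eqP => /eqP; rewrite subr_eq0 => /eqP hE.
    have /th /eqP : ev1 cst h ('X - a%:P) = 0 by rewrite ev1B ev1X ev1C hE subrr.
    by rewrite polyXsubC_eq0.
  exists (h - cst a)^-1, (- f * (h - cst a) ^+ 2); split.
  - apply: not_cst_transcendental => c E.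
    have hE : h = cst (a + c^-1) by rewrite rmorphD fmorphV -E invrK addrC subrK.
    have /th /eqP : ev1 cst h ('X - (a + c^-1)%:P) = 0 by rewrite ev1B ev1X ev1C -hE subrr.
    by rewrite polyXsubC_eq0.
  - by move=> h'; apply: (pair_unit_notI (Lv p) ha0 h' ma).
  - move=> e de; rewrite (der_inv (de : cst_derivation cst e)) //.
    have -> : e (h - cst a) = e h.
      rewrite (derD (de : cst_derivation cst e)) -rmorphN /=.
      by rewrite (derC (de : cst_derivation cst e)) addr0.
    by field.
have x_neq a : x - cst a != 0.
  apply/eqP => E; have /tx /eqP : ev1 cst x ('X - a%:P) = 0 by rewrite ev1B ev1X ev1C.
  by rewrite polyXsubC_eq0.
have x0 : x != 0 by have := x_neq 0; rewrite rmorph0 subr0.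
have mxp : local_max p x^-1.
  case: (valuation_total (Lv p) x0) => // Ox.
  case: (pselect (local_max p x^-1)) => // nm; case: nOx.
  by rewrite -(invrK x); apply: (local_inv (Lv p)).
have away P y : P <> p -> y != 0 -> (forall e, derivation e -> e y = e x) ->
    ~ unit_of (local_ring P) (local_max P) y -> local_max P (f' * y).
  move=> Pp y0 ey nUy; have [k k0 [t' [e [ut' de et' oP]]]] := hreg P Pp.
  have : ord_at P (f' * e y) k by rewrite ey // Ef.
  move=> /(ord_log_differential ut' de et' y0 nUy) /ord_at_max; apply.
  by rewrite ltr_wpDl.
have op' : ord_at p (f' * x) 0.
  have := ord_log_differential ut dd dt x0 (k := -1) (f := f'); rewrite addNr; apply.
    by move=> [].
  by rewrite Ef.
have [t1 [u [ut1 /local_unitE [Ou nu] t10]]] := op'; rewrite expr0z mulr1 => Eu.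
have [c mc] := curve_residue Ou.
have c0 : c = 0; last by apply: nu; move: mc; rewrite c0 rmorph0 subr0.
apply: (@single_log_residue_eq0 _ _ cst (point C) (@local_ring R C) (@local_max R C)
  Lv curve_complete (@curve_trdeg1 R C) x f' p c tx _ _ mxp).
- move=> P a ma; rewrite mulrC; apply: away.
  + move=> Pp; apply: nOx; rewrite -(subrK (cst a) x) -Pp.
    by apply: (pair_add (Lv P)); [apply: (pair_sub (Lv P))|apply: (pair_cst (Lv P))].
  + exact: x_neq.
  + move=> e de; rewrite (derD (de : cst_derivation cst e)) -rmorphN /=.
    by rewrite (derC (de : cst_derivation cst e)) addr0.
  + by move=> [_].
- move=> P Pp mx; rewrite mulrC; apply: away => //.
  by move=> [Ox _]; apply: (pair_unit_notI (Lv P) _ _ mx); rewrite ?invr_eq0 ?invrK.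
- by rewrite mulrC Eu.
Qed.

End Order.

(** * Linear equivalence of divisors *)
Section Divisors.
Context (R : realType) (C : proj_curve R).

Local Notation F := (ratfun C).
Local Notation K := R[i].
Local Notation cst := (cst C).
Local Notation divisor := (divisor C).

Lemma divisor_eq (D E : divisor) : (forall P, coeff P D = coeff P E) -> D = E.
Proof. by move=> h; apply/eqP/freeg_eqP. Qed.

Lemma coeff_point (P Q : point C) : coeff P (<< Q >> : divisor) = (Q == P)%:R.
Proof. by rewrite coeffU mul1r. Qed.

Lemma deg_point (Q : point C) : deg (<< Q >> : divisor) = 1.
Proof. exact: degU. Qed.

Lemma effective_points (D : divisor) m : effective D -> deg D = m%:Z ->
  exists Q : 'I_m -> point C, D = \sum_i << Q i >>.
Proof.
elim: m D => [|m IH] D eD dD.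
  have D0 : D = 0 by apply: fgpos_eq0P => //; apply/fgposP.
  have Q : 'I_0 -> point C by case.
  by exists Q; rewrite big_ord0.
have [x x1] : exists x, 1 <= coeff x D.
  apply: contrapT => nx; have D0 : D = 0.
    apply: divisor_eq => P; rewrite coeff0; apply/eqP; rewrite eq_le eD andbT.
    by rewrite leNgt; apply/negP => h; apply: nx; exists P; lia.
  by move: dD; rewrite D0 deg0.
have [|| Q EQ] := IH (D - << x >>).
- move=> P; rewrite coeffB coeff_point; case: eqP => [<-|_]; first by rewrite subr_ge0.
  by rewrite subr0; exact: eD.
- by rewrite degB dD deg_point intS addrC addKr.
exists (fun i => oapp Q x (unlift ord0 i)); rewrite big_ord_recl unlift_none /=.
under eq_bigr do rewrite liftK /=.
by rewrite -EQ addrC subrK.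
Qed.

Definition principal (D : divisor) : Prop := exists f : F, forall P, ord_at P f (coeff P D).

Lemma principalD D E : principal D -> principal E -> principal (D + E).
Proof.
by move=> [f hf] [h hh]; exists (f * h) => P; rewrite coeffD; apply: ord_atM.
Qed.

Lemma principalN D : principal D -> principal (- D).
Proof. by move=> [f hf]; exists f^-1 => P; rewrite coeffN; apply: ord_atV. Qed.

Lemma principalB D E : principal D -> principal E -> principal (D - E).
Proof. by move=> pD pE; apply: principalD => //; apply: principalN. Qed.

Lemma canonical_regular (W : divisor) : Defs.canonical W ->
  forall P : point C, exists t d, [/\ uniformizer P t, derivation d & d t = 1].
Proof. by move=> [f [h H]] P; have [t [d [ut dd dt _]]] := H P; exists t, d. Qed.

(** The quotient of the differentials f dh and f' dh' is a function, computed
    with any derivation of F; at P it has the expected order because two local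
    derivations d/dt and d/dt' differ by the unit dt/dt'. *)
Lemma canonical_principal (W W' : divisor) :
  Defs.canonical W -> Defs.canonical W' -> principal (W - W').
Proof.
move=> [f [h H]] [f' [h' H']].
case: (pselect (exists P : point C, True)) => [[P0 _]|nP]; last first.
  by exists 1 => P; case: nP; exists P.
have [t0 [e [_ de _ o0]]] := H' P0.
have eh0 : e h' != 0.
  by have := ord_at_neq0 o0; rewrite mulf_eq0 negb_or => /andP [].
exists ((f * e h) / (f' * e h')) => P.
have [t [d [ut dd dt oP]]] := H P; have [t' [d' [ut' dd' dt' oP']]] := H' P.
have prop := der_proportional (@curve_trdeg1 R C).
have tn0 := local_parameter_neq0 dd dt; have t'n0 := local_parameter_neq0 dd' dt'.
have [w Uw tw] := uniformizer_ratio ut' t'n0 ut tn0.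
have Ud't : unit_of (local_ring P) (local_max P) (d' t).
  rewrite tw (derM (dd' : cst_derivation cst d')) dt' mulr1 addrC.
  apply: (unit_addI (curve_local_pair P) Uw).
  apply: (pair_mulI (curve_local_pair P)); last exact: ut'.1.
  by apply: (derivation_integral ut' dd' dt'); apply: Uw.1.
have d't0 := unit_neq0 (curve_local_pair P) ut.1 Ud't.
have Edh' : d' h' = d h' * d' t by rewrite (prop d d' h' t dd dd') dt mul1r.
have dh'0 : d h' != 0.
  by have := ord_at_neq0 oP'; rewrite Edh' !mulf_eq0 !negb_or => /andP [_ /andP []].
have f'0 : f' != 0.
  by have := ord_at_neq0 oP'; rewrite mulf_eq0 negb_or => /andP [].
have -> : f * e h / (f' * e h') = (f * d h) * (f' * d' h')^-1 * d' t.
  have E := prop e d h h' de dd.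
  have -> : e h = e h' * d h / d h' by rewrite -E mulfK.
  by rewrite Edh'; field; rewrite d't0 dh'0 eh0 f'0.
rewrite coeffB -[X in ord_at _ _ X]addr0; apply: ord_atM; last exact: (ord_at_unit oP Ud't).
by apply: ord_atM => //; apply: ord_atV.
Qed.

(** Two effective divisors in the same class give the sections 1 and 1/f, which are
    proportional when h0 is 1. *)
Lemma unique_effective (D E : divisor) : h0 D 1 -> effective D -> effective E ->
  principal (D - E) -> D = E.
Proof.
move=> [b [bV _]] eD eE [f hf]; apply: divisor_eq => P0.
have hV P := ord_atV (hf P).
have [c1 E1] : exists c : 'I_1 -> K, 1 = \sum_(i < 1) cst (c i) * b i.
  apply/bV; right=> P; exists 0; last by rewrite add0r.
  by rewrite -(rmorph1 cst); apply: (ord_at_cst (hf P)); rewrite oner_eq0.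
have [c2 E2] : exists c : 'I_1 -> K, f^-1 = \sum_(i < 1) cst (c i) * b i.
  apply/bV; right=> P; exists (- coeff P (D - E)) => //.
  by rewrite coeffB opprB subrK.
rewrite big_ord1 in E1; rewrite big_ord1 in E2.
have c10 : cst (c1 ord0) != 0.
  by apply/eqP => h; move/eqP: E1; rewrite h mul0r oner_eq0.
have Ef : f^-1 = cst (c2 ord0 / c1 ord0).
  rewrite fmorph_div E2; apply: (mulIf c10); rewrite divfK // -mulrA [b _ * _]mulrC -E1.
  by rewrite mulr1.
have c0 : c2 ord0 / c1 ord0 != 0 by rewrite -(fmorph_eq0 cst) -Ef (ord_at_neq0 (hV P0)).
have := hV P0; rewrite Ef => /ord_at_uniq /(_ (ord_at_cst (hf P0) c0)) /eqP.
by rewrite oppr_eq0 coeffB subr_eq0 => /eqP.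
Qed.

(** If phi has divisor D, then W + D is the divisor of phi times a differential with
    divisor W. *)
Lemma no_single_simple_pole_divisor (W D : divisor) (p : point C) :
  Defs.canonical W -> principal D ->
  (forall P, P <> p -> 0 <= coeff P (W + D)) -> coeff p (W + D) <> -1.
Proof.
move=> cW [phi hphi] pos neg; have reg := canonical_regular cW.
case: cW => f [h H].
have HW P : ord_diff_at P (f * phi) h (coeff P (W + D)).
  have [t [d [ut dd dt oP]]] := H P; exists t, d; split=> //.
  by rewrite mulrAC coeffD; apply: ord_atM.
apply: (@no_single_simple_pole R C reg (f * phi) h p).
  by move=> P Pp; exists (coeff P (W + D)); [apply: pos|apply: HW].
by rewrite -neg.
Qed.

End Divisors.

(** * Divisors in the locus *)
Theorem proposition5p3 (R : realType) (C : proj_curve R) (smC : smooth C)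
  (g : nat) (genusC : has_genus C g)
  (kappa : divisor C) (theta_kappa : theta_characteristic g kappa)
  (l : nat) (l_ge2 : (2 <= l)%N) (l_le : (l <= g - 1)%N)
  (p : 'I_l -> point C) (q : 'I_(l - 2) -> point C)
  (p_inj : injective p) (q_inj : injective q) (pq_neq : forall i j, p i <> q j)
  (a : 'I_l -> divisor C) (deg_a : forall j, deg (a j) = 0)
  (two_a : forall j, lin_equiv (a j *+ 2)
     (<< p j >> *+ 2 + \sum_i << q i >> - \sum_i << p i >>))
  (add_a : forall j k, lin_equiv (a j + a k)
     (<< p j >> + << p k >> + \sum_i << q i >> - \sum_i << p i >>))
  (a_smooth : forall j, theta_smooth g kappa (a j))
  (M : divisor C) (a_fiber : forall j, gauss g kappa (a j) M) :
  B_locus g l M.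
Proof.
have /choice [D HD] := a_fiber.
have j0 : 'I_l by exists 0%N; apply: leq_trans l_ge2.
have [_ [_ _ cM eM _]] := conj I (HD j0).
have eD j : effective (D j) by case: (HD j) => [[]].
have deg_D j : deg (D j) = g%:Z - 1 by case: (HD j) => [[]].
have aD j : principal (a j - (D j - kappa)) by case: (HD j) => [[_ _ h]].
have h0D j : h0 (D j) 1 by case: (HD j).
have eMD j : effective (M - D j) by case: (HD j).
(* D_j - D_k ~ p_j - p_k, from a_j - a_k = (a_j + a_k) - 2 a_k. *)
have DD j k : principal (D j - D k - << p j >> + << p k >>).
  have := principalB (principalB (principalD (add_a j k) (aD k)) (aD j)) (two_a k).
  congr principal; apply: divisor_eq => P.
  by rewrite !(coeffD, coeffB, coeffN, coeffMn); ring.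
(* The residue theorem forces p_k into M - D_j. *)
have pMD j k : k != j -> 0 < coeff (p k) (M - D j).
  move=> kj; rewrite lt_neqAle eMD andbT; apply/eqP => MD0.
  have pkj : (p j == p k) = false by rewrite (inj_eq p_inj) eq_sym (negbTE kj).
  have Dk0 := eD k (p k); have Mk := eMD k (p k); rewrite coeffB in Mk; rewrite coeffB in MD0.
  have [Dk1|Dk1] := ltP 0 (coeff (p k) (D k)).
    have E : D j = D k - << p k >> + << p j >>.
      apply: unique_effective => //.
        move=> P; rewrite coeffD coeffB !coeff_point; have := eD k P.
        case: eqP => [<-|_]; case: eqP => _ /=; lia.
      have := DD j k; congr principal; apply: divisor_eq => P.
      by rewrite !(coeffD, coeffB, coeffN); ring.
    by move: MD0 Mk; rewrite E coeffD coeffB !coeff_point eqxx pkj /=; lia.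
  apply: (@no_single_simple_pole_divisor R C M (- (D j - D k - << p j >> + << p k >>)) (p k) cM).
  - exact: principalN.
  - move=> P Pk; have := eMD j P; have := eD k P.
    rewrite !(coeffD, coeffB, coeffN, coeff_point) => h1 h2.
    have -> : (p k == P) = false by apply/eqP => h; apply: Pk.
    by case: (p j == P) => /=; lia.
  - rewrite !(coeffD, coeffB, coeffN, coeff_point) eqxx pkj /=; lia.
pose S := \sum_(i | i != j0) (<< p i >> : divisor C).
pose N := M - D j0 - S.
have Ssum : \sum_i (<< p i >> : divisor C) = << p j0 >> + S by rewrite (bigD1 j0).
have eN : effective N.
  move=> P; rewrite /N coeffB raddf_sum /=.
  case: (pselect (exists2 i, i != j0 & p i = P)) => [[i ij iP]|np].
    rewrite (bigD1 i) //= coeff_point iP eqxx big1 => [|k /andP [_ ki]].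
      have := pMD j0 i ij; rewrite iP; lia.
    by rewrite coeff_point -iP (inj_eq p_inj) (negbTE ki).
  rewrite big1 => [|k kj]; first by rewrite subr0; apply: eMD.
  by rewrite coeff_point; case: eqP => // kP; case: np; exists k.
have [degk [W cW kW]] := theta_kappa.
have ED : D j0 = N + << p j0 >> + \sum_i << q i >>.
  apply: unique_effective => //.
    move=> P; rewrite coeffD coeffD coeff_point raddf_sum.
    apply: addr_ge0; first by apply: addr_ge0; first exact: eN.
    by apply: sumr_ge0 => i _; rewrite /= coeff_point.
  have h1 := principalB (two_a j0) (principalD (aD j0) (aD j0)).
  have := principalB (principalD h1 kW) (canonical_principal cM cW).
  congr principal; apply: divisor_eq => P.
  by rewrite /N Ssum !(coeffD, coeffB, coeffN, coeffMn); ring.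
have EM : M = (\sum_i << p i >> + \sum_i << q i >>) + N *+ 2.
  have -> : M = D j0 + (N + S).
    by rewrite /N; apply: divisor_eq => P; rewrite !(coeffD, coeffB, coeffN); ring.
  rewrite ED Ssum; apply: divisor_eq => P.
  by rewrite !(coeffD, coeffMn); ring.
have degsum m (r : 'I_m -> point C) : deg (\sum_i (<< r i >> : divisor C)) = m%:Z.
  rewrite raddf_sum /=; under eq_bigr do rewrite deg_point.
  by rewrite sumr_const card_ord; exact: natz.
have degN : deg N = (g - l)%:Z.
  have := deg_D j0; rewrite ED degD degD degsum deg_point; move: (deg N) => x; lia.
split=> //.
have [Q EQ] := effective_points eN degN.
have [||P EP] := @effective_points R C (\sum_i << p i >> + \sum_i << q i >>) (2 * l - 2).
- move=> P; rewrite coeffD !raddf_sum.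
  by rewrite addr_ge0 //; apply: sumr_ge0 => i _; rewrite /= coeff_point.
- by rewrite degD !degsum; lia.
by exists P, Q; rewrite -EP -EQ.
Qed.
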